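(* Let $X$ and $Y$ be uniformly locally finite metric spaces, and let $\Phi\colon C_u^*(X)\to C_u^*(Y)$ be an injective $*$-homomorphism whose range is a hereditary $C^*$-subalgebra of $C_u^*(Y)$. Suppose that every ghost projection in $C_u^*(Y)$ is compact. Then $X$ admits an injective coarse embedding into $Y$.
   Context: A metric space $(Z,d)$ is uniformly locally finite if $\sup_{z\in Z}|B(z,r)|<\infty$ for every $r\ge 0$. For $a\in B(\ell^2(Z))$, the propagation is $\operatorname{prop}(a)=\sup\{d(z,w):\langle a\delta_w,\delta_z\rangle\ne 0\}$ (possibly infinite). The uniform Roe algebra $C_u^*(Z)$ is the operator-norm closure in $B(\ell^2(Z))$ of the operators of finite propagation. A $C^*$-subalgebra $B$ of a $C^*$-algebra $A$ is hereditary if $0\le a\le b$ with $a\in A$, $b\in B$ implies $a\in B$. An operator $T\in C_u^*(Z)$ is a ghost if for every $\varepsilon>0$ there is a finite $F\subseteq Z$ with $|\langle T\delta_z,\delta_w\rangle|<\varepsilon$ for all $z,w\in Z\setminus F$. A ghost projection is a ghost that is a projection. A map $f\colon X\to Y$ between metric spaces is a coarse embedding if there are nondecreasing functions $\rho_-,\rho_+\colon[0,\infty)\to[0,\infty)$ with $\rho_-(t)\to\infty$ as $t\to\infty$ such that $\rho_-(d_X(x,x'))\le d_Y(f(x),f(x'))\le\rho_+(d_X(x,x'))$ for all $x,x'\in X$. *)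

(* Defs.v *)
(* Scalars are R[i] with R : realType.  Normed modules over R[i] have R[i]-valued
   norms: on ell2 and bop these are l2norm and opnorm, viewed in R[i]. *)
From HB Require Import structures.
From mathcomp Require Import all_boot all_order all_algebra.
From mathcomp Require Import all_classical all_reals all_analysis.
From mathcomp Require Import complex ring.

Set Implicit Arguments.
Unset Strict Implicit.
Unset Printing Implicit Defensive.

Import Order.TTheory GRing.Theory Num.Theory.
Import numFieldNormedType.Exports.
Import Normc.

Local Open Scope classical_set_scope.
Local Open Scope ring_scope.
Local Open Scope complex_scope.

Section esum_bounds.
Context {R : realType} {Z : choiceType}.

Lemma le_esum_lin (f g h : Z -> R) (c d : R) : 0 <= c -> 0 <= d ->
  (forall z, 0 <= g z) -> (forall z, 0 <= h z) ->
  (forall z, f z <= c * g z + d * h z) ->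
  (\esum_(z in [set: Z]) (f z)%:E <=
   c%:E * (\esum_(z in [set: Z]) (g z)%:E) +
   d%:E * (\esum_(z in [set: Z]) (h z)%:E))%E.
Proof.
move=> c0 d0 g0 h0 fgh; apply: ge_ereal_sup => _ [F [finF _] <-].
apply: (@le_trans _ _ (\sum_(z \in F) (c%:E * (g z)%:E + d%:E * (h z)%:E))%E).
  by apply: lee_fsum => // z _; rewrite -!EFinM -EFinD lee_fin.
rewrite fsbig_split//= -!ge0_mule_fsumr; first last.
- by move=> z; rewrite lee_fin.
- by move=> z; rewrite lee_fin.
apply: leeD; apply: lee_wpmul2l; rewrite ?lee_fin//.
- by apply: ereal_sup_ubound; exists F.
- by apply: ereal_sup_ubound; exists F.
Qed.

End esum_bounds.

Section ell2.
Context {R : realType}.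

(* \sum_z |x z|^2, as an extended real. *)
Definition nsq (Z : choiceType) (x : Z -> R[i]) : \bar R :=
  \esum_(z in [set: Z]) (normc (x z) ^+ 2)%:E.

Definition sq_summable (Z : choiceType) : {pred (Z -> R[i])} :=
  fun x => `[< (nsq x < +oo)%E >].

Lemma nsq_ge0 (Z : choiceType) (x : Z -> R[i]) : (0 <= nsq x)%E.
Proof. by apply: esum_ge0 => z _; rewrite lee_fin sqr_ge0. Qed.

Lemma normc_ge0 (c : R[i]) : 0 <= normc c.
Proof. by case: c => a b; exact: sqrtr_ge0. Qed.

Lemma nsqZ_le (Z : choiceType) (c : R[i]) (x : Z -> R[i]) :
  (nsq (c *: x) <= (normc c ^+ 2)%:E * nsq x)%E.
Proof.
apply: (@le_trans _ _ ((normc c ^+ 2)%:E * nsq x + 0%:E * nsq x)%E).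
  apply: le_esum_lin => //; rewrite ?sqr_ge0// => z; rewrite ?sqr_ge0//.
  by rewrite mul0r addr0 -exprMn -normcM.
by rewrite mul0e adde0.
Qed.

Lemma nsqD_le (Z : choiceType) (t : R) (x y : Z -> R[i]) : 0 < t ->
  (nsq (x + y)%R <= (1 + t)%:E * nsq x + (1 + t^-1)%:E * nsq y)%E.
Proof.
move=> t0; apply: le_esum_lin => [||z|z|z]; rewrite ?sqr_ge0//.
- by rewrite addr_ge0// ltW.
- by rewrite addr_ge0// invr_ge0 ltW.
set a := normc (x z); set b := normc (y z).
have a0 : 0 <= a by exact: normc_ge0.
have b0 : 0 <= b by exact: normc_ge0.
have ab : normc ((x + y) z) <= a + b by exact: le_normcD.
apply: (@le_trans _ _ ((a + b) ^+ 2)).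
  by apply: lerXn2r; rewrite ?nnegrE ?addr_ge0 ?normc_ge0.
rewrite -subr_ge0 [X in 0 <= X](_ : _ = t^-1 * (t * a - b) ^+ 2); last first.
  by field; rewrite gt_eqF.
by rewrite mulr_ge0 ?sqr_ge0// invr_ge0 ltW.
Qed.

Lemma sq_summable_closed (Z : choiceType) : subsemimod_closed (@sq_summable Z).
Proof.
split; [split|].
- rewrite -topredE; apply/asboolP; rewrite /nsq esum1// => z _.
  by rewrite [X in normc X](_ : _ = 0)// normc0 expr0n.
- move=> x y; rewrite -!topredE => /asboolP x2 /asboolP y2.
  apply/asboolP; apply: (le_lt_trans (nsqD_le _ _ ltr01)).
  by apply: lte_add_pinfty; apply: lte_mul_pinfty; rewrite ?lee_fin.
- move=> c x; rewrite -!topredE => /asboolP x2.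
  apply/asboolP; apply: (le_lt_trans (nsqZ_le _ _)).
  by apply: lte_mul_pinfty; rewrite ?lee_fin ?sqr_ge0.
Qed.


End ell2.

Definition ell2 (R : realType) (Z : choiceType) :=
  {x : Z -> R[i] | x \in @sq_summable R Z}.

HB.instance Definition _ (R : realType) (Z : choiceType) :=
  Choice.on (ell2 R Z).
HB.instance Definition _ (R : realType) (Z : choiceType) :=
  SubType.on (ell2 R Z).
HB.instance Definition _ (R : realType) (Z : choiceType) :=
  GRing.SubChoice_isSubLmodule.Build R[i] (Z -> R[i]) (@sq_summable R Z) (ell2 R Z)
    (@sq_summable_closed R Z).

Section ell2_norm.
Context {R : realType} {Z : choiceType}.
Implicit Types x y : ell2 R Z.

Definition l2norm x : R := Num.sqrt (fine (nsq (val x))).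

Lemma nsqK x : nsq (val x) = (l2norm x ^+ 2)%:E.
Proof.
have /asboolP xoo : sq_summable (val x) by exact: (valP x).
rewrite sqr_sqrtr ?fine_ge0 ?nsq_ge0// fineK// ge0_fin_numE// ?nsq_ge0//.
Qed.

Lemma l2norm_ge0 x : 0 <= l2norm x. Proof. exact: sqrtr_ge0. Qed.

Lemma l2norm_eq0 x : l2norm x = 0 -> x = 0.
Proof.
move=> x0; apply/val_inj/funext => z /=; apply: eq0_normc.
have : ((normc (val x z) ^+ 2)%:E <= nsq (val x))%E.
  apply: esum_ge; exists [set z]; first by split.
  by rewrite fsbig_set1.
rewrite nsqK x0 expr0n lee_fin => zle0.
by apply/eqP; rewrite -sqrf_eq0 eq_le zle0 sqr_ge0.
Qed.

Lemma l2normZ_le (c : R[i]) x : l2norm (c *: x) <= normc c * l2norm x.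
Proof.
rewrite -(@ler_pXn2r _ 2) ?nnegrE ?mulr_ge0 ?l2norm_ge0 ?normc_ge0// exprMn.
by rewrite -lee_fin (EFinM (normc c ^+ 2)) -!nsqK; exact: nsqZ_le.
Qed.

Lemma l2normZ (c : R[i]) x : l2norm (c *: x) = normc c * l2norm x.
Proof.
apply/eqP; rewrite eq_le l2normZ_le/=.
have [->|c0] := eqVneq c 0; first by rewrite normc0 mul0r l2norm_ge0.
have nc0 : 0 < normc c.
  rewrite lt_neqAle normc_ge0 andbT eq_sym.
  by apply/eqP => /eq0_normc/eqP; rewrite (negPf c0).
have := l2normZ_le c^-1 (c *: x).
by rewrite scalerA mulVf// scale1r normcV mulrC ler_pdivlMr// mulrC.
Qed.

Lemma l2normD x y : l2norm (x + y) <= l2norm x + l2norm y.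
Proof.
have [x0|x0] := eqVneq (l2norm x) 0.
  by rewrite (l2norm_eq0 x0) add0r lerDr l2norm_ge0.
have [y0|y0] := eqVneq (l2norm y) 0.
  by rewrite (l2norm_eq0 y0) addr0 lerDl l2norm_ge0.
set a := l2norm x; set b := l2norm y.
have a0 : 0 < a by rewrite lt_neqAle eq_sym x0 l2norm_ge0.
have b0 : 0 < b by rewrite lt_neqAle eq_sym y0 l2norm_ge0.
have := @nsqD_le R Z (b / a) (val x) (val y) (divr_gt0 b0 a0).
rewrite -[X in nsq X]/(val (x + y)) !nsqK -/a -/b -!EFinM -EFinD lee_fin => h.
rewrite -(@ler_pXn2r _ 2) ?nnegrE ?addr_ge0 ?l2norm_ge0//.
apply: (le_trans h); rewrite le_eqVlt; apply/orP; left; apply/eqP.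
by field; rewrite !gt_eqF.
Qed.

Let normD x y : (l2norm (x + y))%:C <= (l2norm x)%:C + (l2norm y)%:C.
Proof. by rewrite -rmorphD lecR; exact: l2normD. Qed.

Let normZ (c : R[i]) x : (l2norm (c *: x))%:C = `|c| * (l2norm x)%:C.
Proof. by rewrite l2normZ rmorphM; case: c. Qed.

Let norm_eq0 x : (l2norm x)%:C = 0 -> x = 0.
Proof. by move=> /complexI/l2norm_eq0. Qed.

HB.instance Definition _ := Lmodule_isNormed.Build R[i] (ell2 R Z)
  normD normZ norm_eq0.

End ell2_norm.


Section inner.
Context {R : realType} {Z : choiceType}.

(* The unconditional sum of a summable real (resp. complex) family; a junk value
   otherwise. *)
Definition rsum (f : Z -> R) : R :=
  fine (\esum_(z in [set: Z]) (Num.max (f z) 0)%:E) -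
  fine (\esum_(z in [set: Z]) (Num.max (- f z) 0)%:E).

Definition csum (f : Z -> R[i]) : R[i] :=
  rsum (fun z => complex.Re (f z)) +i* rsum (fun z => complex.Im (f z)).

(* Linear on the left; the family below is summable by Cauchy-Schwarz. *)
Definition inner (x y : ell2 R Z) : R[i] :=
  csum (fun z => val x z * (val y z)^*).

Lemma delta_subproof (w : Z) :
  (fun z => (z == w)%:R : R[i]) \in @sq_summable R Z.
Proof.
rewrite -topredE; apply/asboolP.
rewrite /nsq (esumID [set w]); last by move=> z _; rewrite lee_fin sqr_ge0.
rewrite setTI esum_set1 ?lee_fin ?sqr_ge0// esum1 ?adde0 ?ltry//.
by move=> z [_ /eqP/negPf ->]; rewrite normc0 expr0n.
Qed.

Definition delta (w : Z) : ell2 R Z :=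
  exist (fun x => x \in @sq_summable R Z) _ (delta_subproof w).

End inner.

Section bounded_operators.
Context {R : realType} {Z : choiceType}.
Notation H := (ell2 R Z).

Definition bounded_linear : {pred (H -> H)} := fun f =>
  `[< linear f /\ exists M : R, forall x, l2norm (f x) <= M * l2norm x >].

Lemma bounded_linear_closed : subsemimod_closed bounded_linear.
Proof.
split; [split|].
- rewrite -topredE; apply/asboolP; split.
    by move=> c x y; rewrite [LHS](_ : _ = 0)// scaler0 addr0.
  exists 0 => x; rewrite mul0r [X in l2norm X](_ : _ = 0)//.
  by rewrite -(scale0r (0 : H)) l2normZ normc0 mul0r.
- move=> f g; rewrite -!topredE => /asboolP[lf [M fM]] /asboolP[lg [N gN]].
  apply/asboolP; split.
    move=> c x y; rewrite ![(f + g) _]/(f _ + g _) lf lg scalerDr.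
    by rewrite addrACA.
  exists (M + N) => x; rewrite mulrDl.
  by apply: (le_trans (l2normD _ _)); apply: lerD.
- move=> k f; rewrite -!topredE => /asboolP[lf [M fM]].
  apply/asboolP; split.
    move=> c x y; rewrite -[LHS]/(k *: f (c *: x + y)).
    rewrite -[RHS]/(c *: (k *: f x) + k *: f y).
    by rewrite lf scalerDr !scalerA mulrC.
  exists (normc k * M) => x; rewrite -mulrA.
  by rewrite [(k *: f) _]/(k *: f _) l2normZ ler_wpM2l// normc_ge0.
Qed.

End bounded_operators.

Definition bop (R : realType) (Z : choiceType) :=
  {f : ell2 R Z -> ell2 R Z | f \in @bounded_linear R Z}.

HB.instance Definition _ (R : realType) (Z : choiceType) :=
  Choice.on (bop R Z).
HB.instance Definition _ (R : realType) (Z : choiceType) :=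
  SubType.on (bop R Z).
HB.instance Definition _ (R : realType) (Z : choiceType) :=
  GRing.SubChoice_isSubLmodule.Build R[i] (ell2 R Z -> ell2 R Z)
    (@bounded_linear R Z) (bop R Z) (@bounded_linear_closed R Z).

Definition bop_fun (R : realType) (Z : choiceType) (a : bop R Z) :
  ell2 R Z -> ell2 R Z := val a.
Coercion bop_fun : bop >-> Funclass.

Section bop_theory.
Context {R : realType} {Z : choiceType}.
Implicit Types (a b c : bop R Z) (x y : ell2 R Z).

Lemma bop_linear a : linear a.
Proof. by have /asboolP[] : bounded_linear (val a) by exact: valP. Qed.

Lemma bop_bounded a : exists M : R, forall x, l2norm (a x) <= M * l2norm x.
Proof. by have /asboolP[] : bounded_linear (val a) by exact: valP. Qed.

Lemma bopP a b : a =1 b -> a = b.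
Proof. by move=> ab; apply/val_inj/funext. Qed.

Lemma bop0 a : a 0 = 0.
Proof. by have := bop_linear a (-1) 0 0; rewrite scaler0 addr0 scaleN1r addNr. Qed.

Lemma bopD a x y : a (x + y) = a x + a y.
Proof. by have := bop_linear a 1 x y; rewrite !scale1r. Qed.

Lemma bopZ a k x : a (k *: x) = k *: a x.
Proof. by have := bop_linear a k x 0; rewrite bop0 !addr0. Qed.

Lemma bop1_subproof : (id : ell2 R Z -> ell2 R Z) \in bounded_linear.
Proof.
by rewrite -topredE; apply/asboolP; split=> //; exists 1 => x; rewrite mul1r.
Qed.

Lemma bopM_subproof a b : a \o b \in bounded_linear.
Proof.
rewrite -topredE; apply/asboolP; split.
  by move=> k x y /=; rewrite !bop_linear.
have [M aM] := bop_bounded a; have [N bN] := bop_bounded b.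
exists (Num.max M 0 * N) => x /=; apply: (le_trans (aM _)).
apply: (@le_trans _ _ (Num.max M 0 * l2norm (b x))).
  by rewrite ler_wpM2r ?l2norm_ge0// le_max lexx.
by rewrite -mulrA ler_wpM2l// le_max lexx orbT.
Qed.

Definition bop_one : bop R Z :=
  exist (fun f => f \in @bounded_linear R Z) _ bop1_subproof.
Definition bop_mul a b : bop R Z := 
  exist (fun f => f \in @bounded_linear R Z) _ (bopM_subproof a b).

Let mulA : associative bop_mul. Proof. by move=> a b c; apply: bopP. Qed.
Let mul1 : left_id bop_one bop_mul. Proof. by move=> a; apply: bopP. Qed.
Let mulr1 : right_id bop_one bop_mul. Proof. by move=> a; apply: bopP. Qed.
Let mulDl : left_distributive bop_mul +%R.
Proof. by move=> a b c; apply: bopP. Qed.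
Let mulDr : right_distributive bop_mul +%R.
Proof. by move=> a b c; apply: bopP => x; exact: bopD. Qed.

(* Multiplication in B(l^2(Z)) is composition. *)
HB.instance Definition _ := GRing.Zmodule_isPzRing.Build (bop R Z)
  mulA mul1 mulr1 mulDl mulDr.

Definition opnorm a : R :=
  sup [set l2norm (a x) | x in [set x | l2norm x <= 1]].

Lemma l2norm0 : l2norm (0 : ell2 R Z) = 0.
Proof. by rewrite -(scale0r 0) l2normZ normc0 mul0r. Qed.

Lemma normcR (r : R) : 0 <= r -> normc r%:C = r.
Proof. by move=> r0; rewrite /normc/= expr0n addr0 sqrtr_sqr ger0_norm. Qed.

Lemma opnorm_has_sup a :
  has_sup [set l2norm (a x) | x in [set x | l2norm x <= 1]].
Proof.
split; first by exists (l2norm (a 0)), 0 => //=; rewrite l2norm0.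
have [M aM] := bop_bounded a; exists (Num.max M 0) => _ [x /= x1 <-].
apply: (le_trans (aM x)); apply: (@le_trans _ _ (Num.max M 0 * l2norm x)).
  by rewrite ler_wpM2r ?l2norm_ge0// le_max lexx.
by rewrite ler_piMr// le_max lexx orbT.
Qed.

Lemma opnorm_ge0 a : 0 <= opnorm a.
Proof.
apply: (@le_trans _ _ (l2norm (a 0))); first exact: l2norm_ge0.
apply: ub_le_sup; first exact: (opnorm_has_sup a).2.
by exists 0 => //=; rewrite l2norm0.
Qed.

Lemma l2norm_le_opnorm a x : l2norm (a x) <= opnorm a * l2norm x.
Proof.
have [x0|x0] := eqVneq (l2norm x) 0.
  by rewrite (l2norm_eq0 x0) bop0 l2norm0 mulr0.
have {}x0 : 0 < l2norm x by rewrite lt_neqAle eq_sym x0 l2norm_ge0.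
rewrite -ler_pdivrMr//.
have xV : 0 <= (l2norm x)^-1 by rewrite invr_ge0 ltW.
suff -> : l2norm (a x) / l2norm x = l2norm (a ((l2norm x)^-1%:C *: x)).
  apply: ub_le_sup; first exact: (opnorm_has_sup a).2.
  by exists ((l2norm x)^-1%:C *: x) => //=; rewrite l2normZ normcR// mulVf// gt_eqF.
by rewrite bopZ l2normZ normcR// mulrC.
Qed.

Lemma opnorm_le a (M : R) : 0 <= M ->
  (forall x, l2norm (a x) <= M * l2norm x) -> opnorm a <= M.
Proof.
move=> M0 aM; apply: ge_sup; first exact: (opnorm_has_sup a).1.
by move=> _ [x /= x1 <-]; apply: (le_trans (aM x)); rewrite ler_piMr.
Qed.

Lemma opnormD a b : opnorm (a + b) <= opnorm a + opnorm b.
Proof.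
apply: opnorm_le => [|x]; first by rewrite addr_ge0 ?opnorm_ge0.
rewrite mulrDl; apply: (le_trans (l2normD (a x) (b x))).
by apply: lerD; exact: l2norm_le_opnorm.
Qed.

Lemma opnormZ_le (k : R[i]) a : opnorm (k *: a) <= normc k * opnorm a.
Proof.
apply: opnorm_le => [|x]; first by rewrite mulr_ge0 ?opnorm_ge0 ?normc_ge0.
rewrite -[X in l2norm X]/(k *: a x) l2normZ -mulrA.
by apply: ler_wpM2l; [exact: normc_ge0|exact: l2norm_le_opnorm].
Qed.

Lemma opnormZ (k : R[i]) a : opnorm (k *: a) = normc k * opnorm a.
Proof.
apply/eqP; rewrite eq_le opnormZ_le/=.
have [->|k0] := eqVneq k 0; first by rewrite normc0 mul0r opnorm_ge0.
have nk0 : 0 < normc k.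
  rewrite lt_neqAle normc_ge0 andbT eq_sym.
  by apply/eqP => /eq0_normc/eqP; rewrite (negPf k0).
have := opnormZ_le k^-1 (k *: a).
by rewrite scalerA mulVf// scale1r normcV mulrC ler_pdivlMr// mulrC.
Qed.

Lemma opnorm_eq0 a : opnorm a = 0 -> a = 0.
Proof.
move=> a0; apply: bopP => x; apply: l2norm_eq0; apply/eqP.
by rewrite eq_le l2norm_ge0 andbT -(mul0r (l2norm x)) -a0 l2norm_le_opnorm.
Qed.

Let normD a b : (opnorm (a + b))%:C <= (opnorm a)%:C + (opnorm b)%:C.
Proof. by rewrite -rmorphD lecR; exact: opnormD. Qed.

Let normZ (k : R[i]) a : (opnorm (k *: a))%:C = `|k| * (opnorm a)%:C.
Proof. by rewrite opnormZ rmorphM; case: k. Qed.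

Let norm_eq0 a : (opnorm a)%:C = 0 -> a = 0.
Proof. by move=> /complexI/opnorm_eq0. Qed.

HB.instance Definition _ := Lmodule_isNormed.Build R[i] (bop R Z)
  normD normZ norm_eq0.

(* "b = a^*": by Riesz every a has exactly one such b. *)
Definition is_adjoint a b :=
  forall x y, inner (a x) y = inner x (b y).

Definition positive_op a := forall x, 0 <= inner (a x) x.

Definition projection a := a * a = a /\ is_adjoint a a.

(* The image of the closed unit ball is relatively compact in norm. *)
Definition compact_op a := compact (closure (a @` [set x | `|x| <= 1])).

(* B is a C^*-subalgebra of A. *)
Definition Cstar_subalgebra (A B : set (bop R Z)) :=
  [/\ B `<=` A,
      B 0 /\ (forall (k : R[i]) a b, B a -> B b -> B (k *: a + b)),
      (forall a b, B a -> B b -> B (a * b)),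
      (forall a b, B a -> is_adjoint a b -> B b) &
      closed B].

Definition hereditary (A B : set (bop R Z)) :=
  forall a b, A a -> B b -> positive_op a -> positive_op (b - a) -> B a.

End bop_theory.

(* A map Phi on B(l^2(X)) stands for its restriction to A;
   nothing is required of its values outside A. *)
Definition star_homomorphism (R : realType) (X Y : choiceType)
    (A : set (bop R X)) (B : set (bop R Y)) (Phi : bop R X -> bop R Y) :=
  [/\ {homo Phi : a / A a >-> B a},
      forall (k : R[i]) a b, A a -> A b -> Phi (k *: a + b) = k *: Phi a + Phi b,
      forall a b, A a -> A b -> Phi (a * b) = Phi a * Phi b &
      forall a b, A a -> A b -> is_adjoint a b -> is_adjoint (Phi a) (Phi b)].

Section coarse.
Context {R : realType}.

Definition uniformly_locally_finite (Z : metricType R) :=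
  forall r : R, 0 <= r ->
    exists n : nat, forall z : Z, ([set w | mdist z w <= r] #<= `I_n)%card.

(* The supremum over the empty set (a = 0) is -oo here instead of 0; only the
   finiteness of the propagation is used. *)
Definition propagation (Z : metricType R) (a : bop R Z) : \bar R :=
  ereal_sup [set (mdist zw.1 zw.2)%:E | zw in
    [set zw : Z * Z | inner (a (delta zw.2)) (delta zw.1) != 0]].

Definition uniform_roe (Z : metricType R) : set (bop R Z) :=
  closure [set a | (propagation a < +oo)%E].

Definition ghost (Z : metricType R) (a : bop R Z) :=
  forall eps : R, 0 < eps -> exists2 F : set Z, finite_set F &
    forall z w, ~ F z -> ~ F w -> normc (inner (a (delta z)) (delta w)) < eps.

(* rm and rp stand for their restrictions to [0, +oo[. *)
Definition coarse_embedding (X Y : metricType R) (f : X -> Y) :=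
  exists rm rp : R -> R,
    [/\ {in Num.nneg &, {homo rm : s t / s <= t}} /\
        {in Num.nneg &, {homo rp : s t / s <= t}},
        {in Num.nneg, forall t, 0 <= rm t} /\ {in Num.nneg, forall t, 0 <= rp t},
        rm t @[t --> +oo] --> +oo &
        forall x x', rm (mdist x x') <= mdist (f x) (f x') <= rp (mdist x x')].

End coarse.
Arguments uniform_roe {R} Z.

(* Main.v *)
(* Heredity makes each [Phi (e_xx)] a minimal projection, so [Phi (e_xy) = u_x (x) u_y^*] for an
   orthonormal family [u] in l2(Y), and [prj B := Phi (chi_B)] is the projection onto the span of
   [u_x], [x \in B].

   If [sup_y |u_x(y)|] were not bounded below, a sequence of [x]'s for which it decays
   geometrically would give a noncompact ghost projection; so [|u_x(f x)| >= del] for some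
   [f : X -> Y].

   A gliding hump argument shows that the operators [Phi (pt G)], [G] a finite partial translation
   of X with displacement at most [r], are quasi-local uniformly in [G]; the same holds for the
   compressions to X of the partial translations of Y, which belong to the Roe algebra of X by
   heredity.  Matrix units then show that [f] is a coarse embedding.

   For injectivity, let [d] be a diagonal matrix of signs.  For suitable signs, [Phi d] paired
   with [d] isolates the coefficients [u_x(f x)], and uniform quasi-locality of the [prj B]
   forces the [s]-neighbourhood of [f A] to have at least [#|A|] points for every finite [A], with
   [s] independent of [A].  Hall's theorem yields an injection at distance at most [s] from [f]. *)
Require Import Defs.
From mathcomp Require Import all_boot all_order all_algebra.
From mathcomp Require Import all_classical all_reals all_analysis.
From mathcomp Require Import complex finmap lra ring.

Set Implicit Arguments.
Unset Strict Implicit.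
Unset Printing Implicit Defensive.

Import Order.TTheory GRing.Theory Num.Theory.
Import numFieldNormedType.Exports.
Import Normc.

Local Open Scope classical_set_scope.
Local Open Scope ring_scope.
Local Open Scope complex_scope.

(** * Complex numbers and unconditional sums *)

(** [Phi] is not assumed strongly continuous, so for infinite B algebra alone says of [Phi (chi_B)]
    only that it fixes the [u x] with x in B and kills the others; a further part orthogonal to all
    [u x] is not excluded by it. Heredity fills this gap: each column [prj B (delta y)] defines a
    rank one operator below [prj B], and its preimage bounds the squared norm of the column by the
    sum of |u_x(y)|^2 over x in B. Bounds on such sums drive both the ghost projection and the
    gliding hump. A single operator of the Roe algebra is quasi-local at a scale of its own, whereas
    distance control needs one scale for all finite partial translations. Failure of uniformity is
    refuted by assembling infinitely many bad finite pieces into one operator. The large coordinates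
    make f at most del^-2 to one, but give no room in Y for separating a fibre. Nor does
    concentration of each u_x near f x suffice for Hall's condition, since errors accumulate in
    combinations over a large A; the signs yield an estimate relative to the norm of the whole
    combination. *)

Section normc_extra.
Context {R : realType}.
Implicit Types a b : R[i].

(* [conjc] and [%:C] elaborate along different canonical paths depending on the
   context, which blocks rewriting; [cj] and [rc] fix one path. *)
Definition cj a : R[i] := conjc a.
Definition rc (r : R) : R[i] := r%:C.

Lemma normc_cj a : normc (cj a) = normc a.
Proof. by case: a => x y /=; rewrite sqrrN. Qed.

Lemma rc_sqr_normc a : rc (normc a ^+ 2) = a * cj a.
Proof.
case: a => x y; apply/eqP; rewrite eq_complex /= sqr_sqrtr ?addr_ge0 ?sqr_ge0//.
by apply/andP; split; apply/eqP; ring.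
Qed.

Lemma cjD a b : cj (a + b) = cj a + cj b.
Proof. exact: rmorphD. Qed.

Lemma cjM a b : cj (a * b) = cj a * cj b.
Proof. exact: rmorphM. Qed.

Lemma cjN a : cj (- a) = - cj a.
Proof. exact: rmorphN. Qed.

Lemma cjK a : cj (cj a) = a.
Proof. exact: conjcK. Qed.

Lemma cj0 : cj 0 = 0. Proof. exact: conjc0. Qed.
Lemma cj1 : cj 1 = 1. Proof. exact: conjc1. Qed.
Lemma cj_rc r : cj (rc r) = rc r. Proof. exact: conjc_real. Qed.

Lemma cj_sum (I : Type) (s : seq I) (P : pred I) (f : I -> R[i]) :
  cj (\sum_(i <- s | P i) f i) = \sum_(i <- s | P i) cj (f i).
Proof. exact: rmorph_sum. Qed.

Lemma rcD x y : rc (x + y) = rc x + rc y. Proof. exact: rmorphD. Qed.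
Lemma rcN x : rc (- x) = - rc x. Proof. exact: rmorphN. Qed.
Lemma rcB x y : rc (x - y) = rc x - rc y. Proof. exact: rmorphB. Qed.
Lemma rcM x y : rc (x * y) = rc x * rc y. Proof. exact: rmorphM. Qed.
Lemma rcX x n : rc (x ^+ n) = rc x ^+ n. Proof. exact: rmorphXn. Qed.
Lemma rc0 : rc 0 = 0. Proof. by []. Qed.
Lemma rc1 : rc 1 = 1. Proof. by []. Qed.

Lemma rc_sum (I : Type) (s : seq I) (P : pred I) (f : I -> R) :
  rc (\sum_(i <- s | P i) f i) = \sum_(i <- s | P i) rc (f i).
Proof. exact: rmorph_sum. Qed.

Lemma normc_rc r : normc (rc r) = `|r|.
Proof. by rewrite /= expr0n addr0 sqrtr_sqr. Qed.
Lemma rc_inj : injective rc. Proof. by move=> x y []. Qed.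
Lemma rc_le x y : (rc x <= rc y) = (x <= y). Proof. exact: lecR. Qed.

Lemma normc_eq0 a : (normc a == 0) = (a == 0).
Proof.
by apply/eqP/eqP => [/eq0_normc//|->]; exact: normc0.
Qed.

Lemma normc_gt0 a : (0 < normc a) = (a != 0).
Proof. by rewrite lt_neqAle normc_ge0 andbT eq_sym normc_eq0. Qed.

Lemma Re_le_normc a : complex.Re a <= normc a.
Proof.
case: a => x y /=; apply: (le_trans (ler_norm x)); rewrite -sqrtr_sqr.
by rewrite ler_sqrt ?addr_ge0 ?sqr_ge0// lerDl sqr_ge0.
Qed.

Lemma normr_Re_le_normc a : `|complex.Re a| <= normc a.
Proof.
case: a => x y /=; rewrite -sqrtr_sqr.
by rewrite ler_sqrt ?addr_ge0 ?sqr_ge0// lerDl sqr_ge0.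
Qed.

Lemma normc_le_ReIm a : normc a <= `|complex.Re a| + `|complex.Im a|.
Proof.
case: a => x y /=; rewrite -(@ler_pXn2r _ 2) ?nnegrE ?sqrtr_ge0 ?addr_ge0//.
rewrite sqr_sqrtr ?addr_ge0 ?sqr_ge0// sqrrD !real_normK ?num_real//.
by rewrite addrAC lerDl mulrn_wge0// mulr_ge0.
Qed.

Lemma normr_Im_le_normc a : `|complex.Im a| <= normc a.
Proof.
case: a => x y /=; rewrite -sqrtr_sqr.
by rewrite ler_sqrt ?addr_ge0 ?sqr_ge0// lerDr sqr_ge0.
Qed.

Lemma normc_sum (I : Type) (s : seq I) (P : pred I) (f : I -> R[i]) :
  normc (\sum_(i <- s | P i) f i) <= \sum_(i <- s | P i) normc (f i).
Proof.
elim/big_ind2: _ => [|a x b y ax by_|//]; first by rewrite normc0.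
by apply: (le_trans (le_normcD _ _)); exact: lerD.
Qed.

Lemma le_eps (x y : R) : (forall e, 0 < e -> x <= y + e) -> x <= y.
Proof. by move=> h; apply/ler_addgt0Pr => e e0; exact: h. Qed.

End normc_extra.

Section fset_sums.
Context {R : realType} {Z : choiceType}.

Lemma le_fset_sum (f : Z -> R) (F G : {fset Z}) : (F `<=` G)%fset -> (forall z, 0 <= f z) ->
  \sum_(z <- F) f z <= \sum_(z <- G) f z.
Proof.
move=> FG f0; rewrite (big_fsetID _ (mem F) G)/= (_ : [fset x in G | x \in F]%fset = F).
  by rewrite lerDl sumr_ge0.
by apply/fsetP => x; rewrite !inE/=; apply: andb_idl; exact: (fsubsetP FG).
Qed.

Lemma esum_le_fset (f : Z -> R) (c : R) :
  (forall F : {fset Z}, \sum_(z <- F) f z <= c) ->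
  (\esum_(z in [set: Z]) (f z)%:E <= c%:E)%E.
Proof.
move=> fc; apply: ge_ereal_sup => _ [A [finA _] <-].
by rewrite fsbig_finite//= sumEFin lee_fin.
Qed.

Lemma esum_ge_fset (f : Z -> R) (F : {fset Z}) :
  ((\sum_(z <- F) f z)%:E <= \esum_(z in [set: Z]) (f z)%:E)%E.
Proof.
apply: esum_ge; exists [set` F]; first by split => //; exact: finite_fset.
by rewrite fsbig_finite ?finite_fset//= set_fsetK sumEFin.
Qed.

Lemma esum_fset_ex (f : Z -> R) (e : R) : 0 < e ->
  (forall z, 0 <= f z) -> (\esum_(z in [set: Z]) (f z)%:E < +oo)%E ->
  exists F : {fset Z}, fine (\esum_(z in [set: Z]) (f z)%:E) - e <= \sum_(z <- F) f z.
Proof.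
move=> e0 f0 foo.
have fin : \esum_(z in [set: Z]) (f z)%:E \is a fin_num.
  by rewrite ge0_fin_numE//; apply: esum_ge0 => z _; rewrite lee_fin.
have [_ [A [finA _] <-]] := ub_ereal_sup_adherent e0 fin.
rewrite fsbig_finite//= sumEFin => h; exists (fset_set A).
rewrite -lee_fin; apply: ltW; apply: le_lt_trans h.
by rewrite EFinB fineK.
Qed.

Lemma esum_fset_le (f : Z -> R) (F : {fset Z}) :
  (forall z, 0 <= f z) -> (\esum_(z in [set: Z]) (f z)%:E < +oo)%E ->
  \sum_(z <- F) f z <= fine (\esum_(z in [set: Z]) (f z)%:E).
Proof.
move=> f0 foo; rewrite -lee_fin fineK ?esum_ge_fset// ge0_fin_numE//.
by apply: esum_ge0 => z _; rewrite lee_fin.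
Qed.

Definition abs_summable (f : Z -> R[i]) := exists c, forall F : {fset Z},
  \sum_(z <- F) normc (f z) <= c.

(** Convergence along the net of finite subsets. Identities for [inner] are proved by uniqueness of
    this limit, which avoids the positive and negative parts in the definition of [rsum]. *)
Definition sums_to (f : Z -> R[i]) (s : R[i]) := forall e : R, 0 < e ->
  exists F0 : {fset Z}, forall F : {fset Z}, (F0 `<=` F)%fset ->
    normc (\sum_(z <- F) f z - s) <= e.

Lemma sums_to_unique f s t : sums_to f s -> sums_to f t -> s = t.
Proof.
move=> fs ft; apply/eqP; rewrite -subr_eq0 -normc_eq0 eq_le normc_ge0 andbT.
apply: le_eps => e e0; rewrite add0r.
have e2 : 0 < e / 2 by rewrite divr_gt0.
have [F hF] := fs _ e2; have [G hG] := ft _ e2.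
rewrite (_ : s - t = (\sum_(z <- (F `|` G)%fset) f z - t) - (\sum_(z <- (F `|` G)%fset) f z -
  s)); last by ring.
apply: (le_trans (le_normcD _ _)); rewrite normcN (splitr e).
by apply: lerD; [apply: hG; exact: fsubsetUr|apply: hF; exact: fsubsetUl].
Qed.

Lemma sums_toD f g s t : sums_to f s -> sums_to g t -> sums_to (fun z => f z + g z) (s + t).
Proof.
move=> fs gt e e0; have e2 : 0 < e / 2 by rewrite divr_gt0.
have [F hF] := fs _ e2; have [G hG] := gt _ e2.
exists (F `|` G)%fset => K FGK; rewrite big_split/= opprD addrACA.
apply: (le_trans (le_normcD _ _)); rewrite (splitr e).
by apply: lerD; [apply: hF|apply: hG]; apply: fsubset_trans FGK; rewrite ?fsubsetUr ?fsubsetUl.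
Qed.

Lemma sums_toZ c f s : sums_to f s -> sums_to (fun z => c * f z) (c * s).
Proof.
move=> fs e e0; have c0 : 0 < normc c + 1.
  by rewrite ltr_wpDl// normc_ge0.
have [F hF] := fs _ (divr_gt0 e0 c0); exists F => K FK.
rewrite -mulr_sumr -mulrBr normcM.
apply: (@le_trans _ _ ((normc c + 1) * (e / (normc c + 1)))).
  by apply: ler_pM; rewrite ?normc_ge0 ?lerDl// hF.
by rewrite mulrC divfK ?gt_eqF.
Qed.

Lemma sums_toJ f s : sums_to f s -> sums_to (fun z => cj (f z)) (cj s).
Proof.
move=> fs e e0; have [F hF] := fs _ e0; exists F => K FK.
by rewrite -cj_sum -cjN -cjD normc_cj; exact: hF.
Qed.

Lemma rsum_sums (f : Z -> R) (c e : R) : 0 < e ->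
  (forall F : {fset Z}, \sum_(z <- F) `|f z| <= c) ->
  exists F0 : {fset Z}, forall F : {fset Z}, (F0 `<=` F)%fset ->
    `|\sum_(z <- F) f z - rsum f| <= e.
Proof.
move=> e0 fc; have e2 : 0 < e / 2 by rewrite divr_gt0.
pose p z := Num.max (f z) 0; pose n z := Num.max (- f z) 0.
have p0 z : 0 <= p z by rewrite /p le_max lexx orbT.
have n0 z : 0 <= n z by rewrite /n le_max lexx orbT.
have psum : (\esum_(z in [set: Z]) (p z)%:E < +oo)%E.
  apply: (@le_lt_trans _ _ c%:E); last exact: ltry.
  apply: esum_le_fset => F; apply: le_trans (fc F); apply: ler_sum => z _.
  by rewrite /p ge_max ler_norm normr_ge0.
have nsum : (\esum_(z in [set: Z]) (n z)%:E < +oo)%E.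
  apply: (@le_lt_trans _ _ c%:E); last exact: ltry.
  apply: esum_le_fset => F; apply: le_trans (fc F); apply: ler_sum => z _.
  by rewrite /n ge_max -normrN ler_norm normr_ge0.
have [F1 h1] := esum_fset_ex e2 p0 psum; have [F2 h2] := esum_fset_ex e2 n0 nsum.
exists (F1 `|` F2)%fset => F; rewrite fsubUset => /andP[F1F F2F].
have fpn z : f z = p z - n z.
  by rewrite /p /n !maxEle; do 2![case: leP => ?]; lra.
have -> : \sum_(z <- F) f z = \sum_(z <- F) p z - \sum_(z <- F) n z.
  by rewrite -sumrB; apply: eq_bigr => z _.
have a1 := esum_fset_le F p0 psum; have a2 := esum_fset_le F n0 nsum.
have a3 := le_trans h1 (le_fset_sum F1F p0); have a4 := le_trans h2 (le_fset_sum F2F n0).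
rewrite /rsum -/(p _) -/(n _) ler_norml; move: a1 a2 a3 a4.
rewrite /p /n; set P := fine _; set N := fine _.
by set P' := (\sum_(_ <- _) _); set N' := (\sum_(_ <- _) _); lra.
Qed.

Lemma csum_sums f : abs_summable f -> sums_to f (csum f).
Proof.
move=> [c fc] e e0; have e2 : 0 < e / 2 by rewrite divr_gt0.
have [|F hF] := @rsum_sums (fun z => complex.Re (f z)) c _ e2.
  by move=> F; apply: le_trans (fc F); apply: ler_sum => z _; exact: normr_Re_le_normc.
have [|G hG] := @rsum_sums (fun z => complex.Im (f z)) c _ e2.
  by move=> G; apply: le_trans (fc G); apply: ler_sum => z _; exact: normr_Im_le_normc.
exists (F `|` G)%fset => K FGK; apply: (le_trans (normc_le_ReIm _)); rewrite (splitr e).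
have reim : \sum_(z <- K) f z = (\sum_(z <- K) complex.Re (f z)) +i* (\sum_(z <- K) complex.Im (f
  z)).
  elim/big_rec3: _ => [//|z x y w _ ->]; case: (f z) => a b /=.
  by apply/eqP; rewrite eq_complex /= !eqxx.
rewrite reim /csum/=.
by apply: lerD; [apply: hF|apply: hG]; apply: fsubset_trans FGK; rewrite ?fsubsetUr ?fsubsetUl.
Qed.

End fset_sums.

(** * The Hilbert space l2 *)

Section ell2_extra.
Context {R : realType} {Z : choiceType}.
Implicit Types (x y v : ell2 R Z) (F G : {fset Z}).

(* Unlike [val], [crd] is not unfolded by [/=]. *)
Definition crd x (z : Z) : R[i] := val x z.

Lemma ell2P x y : (forall z, crd x z = crd y z) -> x = y.
Proof. by move=> xy; apply/val_inj/funext. Qed.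

Lemma crdD x y z : crd (x + y) z = crd x z + crd y z. Proof. by []. Qed.
Lemma crdZ k x z : crd (k *: x) z = k * crd x z. Proof. by []. Qed.
Lemma crdN x z : crd (- x) z = - crd x z. Proof. by []. Qed.
Lemma crd_0 z : crd (0 : ell2 R Z) z = 0. Proof. by []. Qed.

Lemma crd_sum (I : Type) (s : seq I) (P : pred I) (f : I -> ell2 R Z) z :
  crd (\sum_(i <- s | P i) f i) z = \sum_(i <- s | P i) crd (f i) z.
Proof. by elim/big_rec2: _ => // i a b _ <-. Qed.

Lemma crd_delta w z : crd (delta w : ell2 R Z) z = (z == w)%:R. Proof. by []. Qed.

Lemma sq_sum_le_norm x F : \sum_(z <- F) normc (crd x z) ^+ 2 <= l2norm x ^+ 2.
Proof. by rewrite -lee_fin -nsqK; exact: esum_ge_fset. Qed.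

Lemma sqr_norm_le x (c : R) : (forall F, \sum_(z <- F) normc (crd x z) ^+ 2 <= c) ->
  l2norm x ^+ 2 <= c.
Proof. by move=> h; rewrite -lee_fin -nsqK; exact: esum_le_fset. Qed.

Lemma ell2_of_bounded_sums (f : Z -> R[i]) (c : R) :
  (forall F, \sum_(z <- F) normc (f z) ^+ 2 <= c) ->
  exists2 x : ell2 R Z, (forall z, crd x z = f z) & l2norm x ^+ 2 <= c.
Proof.
move=> h.
have fs : f \in @sq_summable R Z.
  rewrite -topredE; apply/asboolP; apply: (@le_lt_trans _ _ c%:E); last exact: ltry.
  exact: esum_le_fset.
exists (exist (fun x : Z -> R[i] => x \in @sq_summable R Z) f fs) => //.
exact: sqr_norm_le.
Qed.

Lemma crd_le_norm x z : normc (crd x z) <= l2norm x.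
Proof.
rewrite -(@ler_pXn2r _ 2) ?nnegrE ?normc_ge0 ?l2norm_ge0//.
by have := sq_sum_le_norm x [fset z]%fset; rewrite big_seq_fset1.
Qed.

Definition trunc F x : ell2 R Z := \sum_(z <- F) crd x z *: delta z.

Lemma crd_trunc F x z : crd (trunc F x) z = if z \in F then crd x z else 0.
Proof.
rewrite /trunc crd_sum; case: ifPn => zF.
  rewrite (big_fsetD1 z)//= crdZ crd_delta eqxx mulr1 big1_fset ?addr0// => w.
  by rewrite !inE => /andP[wz _] _; rewrite crdZ crd_delta eq_sym (negPf wz) mulr0.
rewrite big1_fset// => w wF _; rewrite crdZ crd_delta.
by case: eqP wF zF => [->->//|]; rewrite mulr0.
Qed.

Lemma trunc_cvg x (e : R) : 0 < e -> exists F, forall G, (F `<=` G)%fset ->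
  l2norm (x - trunc G x) <= e.
Proof.
move=> e0; have e20 : 0 < e ^+ 2 by rewrite exprn_gt0.
have foo : (\esum_(z in [set: Z]) (normc (crd x z) ^+ 2)%:E < +oo)%E.
  by rewrite -/(nsq (val x)) nsqK ltry.
have [F hF] := esum_fset_ex e20 (fun z => sqr_ge0 (normc (crd x z))) foo.
exists F => G FG; rewrite -(@ler_pXn2r _ 2) ?nnegrE ?l2norm_ge0 ?(ltW e0)//.
apply: sqr_norm_le => K.
move: hF; rewrite -/(nsq (val x)) nsqK/= => hF.
have h1 := sq_sum_le_norm x (G `|` K)%fset.
have h2 := le_fset_sum FG (fun z => sqr_ge0 (normc (crd x z))).
suff : \sum_(z <- K) normc (crd (x - trunc G x) z) ^+ 2 + \sum_(z <- G) normc (crd x z) ^+ 2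
   <= \sum_(z <- (G `|` K)%fset) normc (crd x z) ^+ 2 by lra.
rewrite (big_fsetID _ (mem G) (G `|` K)%fset)/= addrC.
rewrite (_ : [fset z in (G `|` K)%fset | z \in G]%fset = G); last first.
  by apply/fsetP => z; rewrite !inE; case: (z \in G); rewrite ?orbF ?andbF.
rewrite lerD2r (_ : [fset z in (G `|` K)%fset | z \notin G]%fset =
  [fset z in K | z \notin G]%fset); last first.
  by apply/fsetP => z; rewrite !inE; case: (z \in G); case: (z \in K).
rewrite (big_fsetID _ (mem G) K)/= big1_fset ?add0r//; last first.
  move=> z; rewrite !inE => /andP[_ zG] _; rewrite crdD crdN crd_trunc zG subrr.
  by rewrite normc0 expr0n.
rewrite big_seq [leRHS]big_seq; apply: ler_sum => z; rewrite !inE => /andP[_ zG].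
by rewrite crdD crdN crd_trunc (negPf zG) subr0.
Qed.

Lemma l2norm_delta z : l2norm (delta z : ell2 R Z) = 1.
Proof.
apply/eqP; rewrite -(@eqrXn2 _ 2) ?l2norm_ge0// expr1n eq_le; apply/andP; split.
  apply: sqr_norm_le => F; have [zF|zF] := boolP (z \in F).
    rewrite (big_fsetD1 z)//= crd_delta eqxx big1_fset ?addr0 ?normc1 ?expr1n// => w.
    by rewrite !inE => /andP[/negPf wz _] _; rewrite crd_delta wz normc0 expr0n.
  rewrite big1_fset// => w wF _; rewrite crd_delta.
  by case: eqP wF zF => [->->//|]; rewrite normc0 expr0n.
have := sq_sum_le_norm (delta z : ell2 R Z) [fset z]%fset.
by rewrite big_seq_fset1 crd_delta eqxx normc1 expr1n.
Qed.

Lemma l2normN x : l2norm (- x) = l2norm x.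
Proof. by rewrite -scaleN1r l2normZ normcN normc1 mul1r. Qed.

Lemma l2norm_gt0 x : (0 < l2norm x) = (x != 0).
Proof.
rewrite lt_neqAle l2norm_ge0 andbT eq_sym; congr (~~ _).
by apply/eqP/eqP => [/l2norm_eq0//|->]; exact: l2norm0.
Qed.

Lemma inner_abs_summable x y : abs_summable (fun z => crd x z * cj (crd y z)).
Proof.
exists (l2norm x ^+ 2 + l2norm y ^+ 2) => F.
apply: (@le_trans _ _ (\sum_(z <- F) (normc (crd x z) ^+ 2 + normc (crd y z) ^+ 2))).
  apply: ler_sum => z _; rewrite normcM normc_cj.
  have := sqr_ge0 (normc (crd x z) - normc (crd y z)); rewrite sqrrB.
  have := sqr_ge0 (normc (crd x z) + normc (crd y z)); rewrite sqrrD.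
  by rewrite -mulr_natl; lra.
by rewrite big_split lerD// sq_sum_le_norm.
Qed.

Lemma inner_sums x y : sums_to (fun z => crd x z * cj (crd y z)) (inner x y).
Proof. exact/csum_sums/inner_abs_summable. Qed.

Lemma innerDl x y v : inner (x + y) v = inner x v + inner y v.
Proof.
apply: sums_to_unique (inner_sums _ _) _.
have := sums_toD (inner_sums x v) (inner_sums y v).
by under eq_fun do rewrite -mulrDl -crdD.
Qed.

Lemma innerZl k x y : inner (k *: x) y = k * inner x y.
Proof.
apply: sums_to_unique (inner_sums _ _) _.
have := sums_toZ k (inner_sums x y).
by under eq_fun do rewrite mulrA -crdZ.
Qed.

Lemma innerC x y : inner y x = cj (inner x y).
Proof.
apply: sums_to_unique (inner_sums _ _) _.
have := sums_toJ (inner_sums x y).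
by under eq_fun do rewrite cjM cjK mulrC.
Qed.

Lemma innerDr x y v : inner v (x + y) = inner v x + inner v y.
Proof. by rewrite innerC innerDl cjD -!innerC. Qed.

Lemma innerZr k x y : inner x (k *: y) = cj k * inner x y.
Proof. by rewrite innerC innerZl cjM -innerC. Qed.

Lemma innerNl x y : inner (- x) y = - inner x y.
Proof. by rewrite -scaleN1r innerZl mulN1r. Qed.

Lemma innerNr x y : inner x (- y) = - inner x y.
Proof. by rewrite innerC innerNl cjN -innerC. Qed.

Lemma innerBl x y v : inner (x - y) v = inner x v - inner y v.
Proof. by rewrite innerDl innerNl. Qed.

Lemma innerBr x y v : inner v (x - y) = inner v x - inner v y.
Proof. by rewrite innerDr innerNr. Qed.

Lemma inner0l x : inner 0 x = 0.
Proof. by rewrite -(scale0r 0) innerZl mul0r. Qed.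

Lemma inner0r x : inner x 0 = 0.
Proof. by rewrite innerC inner0l cj0. Qed.

Lemma inner_suml (I : Type) (s : seq I) (P : pred I) (f : I -> ell2 R Z) y :
  inner (\sum_(i <- s | P i) f i) y = \sum_(i <- s | P i) inner (f i) y.
Proof.
by elim/big_rec2: _ => [|i a b _ <-]; rewrite ?inner0l ?innerDl.
Qed.

Lemma inner_sumr (I : Type) (s : seq I) (P : pred I) (f : I -> ell2 R Z) y :
  inner y (\sum_(i <- s | P i) f i) = \sum_(i <- s | P i) inner y (f i).
Proof.
by elim/big_rec2: _ => [|i a b _ <-]; rewrite ?inner0r ?innerDr.
Qed.

Lemma inner_deltar x z : inner x (delta z) = crd x z.
Proof.
apply: sums_to_unique (inner_sums _ _) _ => e e0; exists [fset z]%fset => F.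
rewrite fsub1set => zF; rewrite (big_fsetD1 z)//= crd_delta eqxx cj1 mulr1.
rewrite big1_fset ?addr0 ?subrr ?normc0 ?(ltW e0)// => w.
by rewrite !inE => /andP[/negPf wz _] _; rewrite crd_delta wz cj0 mulr0.
Qed.

Lemma inner_deltal x z : inner (delta z) x = cj (crd x z).
Proof. by rewrite innerC inner_deltar. Qed.

Lemma inner_self x : inner x x = rc (l2norm x ^+ 2).
Proof.
apply: sums_to_unique (inner_sums _ _) _ => e e0.
have foo : (\esum_(z in [set: Z]) (normc (crd x z) ^+ 2)%:E < +oo)%E.
  by rewrite -/(nsq (val x)) nsqK ltry.
have [F hF] := esum_fset_ex e0 (fun z => sqr_ge0 (normc (crd x z))) foo.
exists F => G FG; move: hF; rewrite -/(nsq (val x)) nsqK/= => hF.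
have h1 := sq_sum_le_norm x G.
have h2 := le_fset_sum FG (fun z => sqr_ge0 (normc (crd x z))).
under eq_bigr do rewrite -rc_sqr_normc.
rewrite -rc_sum -rcB normc_rc ler0_norm; lra.
Qed.

Lemma cauchy_schwarz x y : normc (inner x y) <= l2norm x * l2norm y.
Proof.
have [->|y0] := eqVneq y 0; first by rewrite inner0r normc0 l2norm0 mulr0.
have {}y0 : 0 < l2norm y by rewrite l2norm_gt0.
set a := inner x y; set n := l2norm y.
(* This vector is |y|^2 x - <x, y> y; its squared norm factors as |y|^2 (|y|^2 |x|^2 - |<x,
   y>|^2). *)
have : 0 <= l2norm (rc n *: (rc n *: x) - a *: y) ^+ 2 by rewrite sqr_ge0.
rewrite -rc_le -inner_self innerBl !innerBr !innerZl !innerZr !inner_self -/n.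
rewrite (innerC x y) -/a !cj_rc.
have -> : rc n * (rc n * (rc n * (rc n * rc (l2norm x ^+ 2)))) - rc n * (rc n * (cj a * a)) -
 (a * (rc n * (rc n * cj a)) - a * (cj a * rc (n ^+ 2))) =
 rc (n ^+ 2 * (n ^+ 2 * l2norm x ^+ 2 - normc a ^+ 2)).
  rewrite (rcM (n ^+ 2)) (rcB (n ^+ 2 * _)) (rcM (n ^+ 2) (_ ^+ 2)) rc_sqr_normc !rcX; ring.
rewrite rc_le pmulr_rge0 ?exprn_gt0// subr_ge0 -exprMn.
by rewrite ler_pXn2r ?nnegrE ?mulr_ge0 ?l2norm_ge0 ?normc_ge0// mulrC.
Qed.

Lemma Re_inner_self x : complex.Re (inner x x) = l2norm x ^+ 2.
Proof. by rewrite inner_self. Qed.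

End ell2_extra.

(** * Operators and partial translations *)

Section operators.
Context {R : realType} {Z : choiceType}.
Implicit Types (x y v : ell2 R Z) (F : {fset Z}) (a b c : bop R Z).

Lemma bopN a x : a (- x) = - a x.
Proof. by rewrite -scaleN1r bopZ scaleN1r. Qed.

Lemma bopB a x y : a (x - y) = a x - a y.
Proof. by rewrite bopD bopN. Qed.

Lemma bop_sum a (I : Type) (s : seq I) (P : pred I) (f : I -> ell2 R Z) :
  a (\sum_(i <- s | P i) f i) = \sum_(i <- s | P i) a (f i).
Proof. by elim/big_rec2: _ => [|i u v _ <-]; rewrite ?bop0 ?bopD. Qed.

Lemma add_bopE a b x : (a + b: bop R Z) x = a x + b x. Proof. by []. Qed.
Lemma scale_bopE k a x : (k *: a: bop R Z) x = k *: a x. Proof. by []. Qed.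
Lemma opp_bopE a x : (- a: bop R Z) x = - a x. Proof. by []. Qed.
Lemma mul_bopE a b x : (a * b: bop R Z) x = a (b x). Proof. by []. Qed.
Lemma one_bopE x : (1 : bop R Z) x = x. Proof. by []. Qed.
Lemma zero_bopE x : (0 : bop R Z) x = 0. Proof. by []. Qed.

Lemma zero_of_le_eps (C d : R) : 0 <= d -> (forall e, 0 < e -> d <= C * e) -> d = 0.
Proof.
move=> d0 h; apply/eqP; rewrite eq_le d0 andbT; apply: le_eps => e e0; rewrite add0r.
have C0 : 0 < `|C| + 1 by rewrite ltr_wpDl.
apply: (le_trans (h _ (divr_gt0 e0 C0))).
rewrite mulrCA ler_piMr ?(ltW e0)// ler_pdivrMr// mul1r.
by apply: le_trans (ler_norm C) _; rewrite lerDl.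
Qed.

Lemma bop_ext a b : (forall z, a (delta z) = b (delta z)) -> a = b.
Proof.
move=> ab; apply: bopP => x; apply/eqP; rewrite -subr_eq0; apply/eqP.
apply: l2norm_eq0; apply: (@zero_of_le_eps (opnorm (a - b))); first exact: l2norm_ge0.
move=> e e0; have [F hF] := trunc_cvg x e0.
have tF : (a - b : bop R Z) (trunc F x) = 0.
  rewrite /trunc bop_sum big1// => z _.
  by rewrite bopZ add_bopE opp_bopE ab subrr scaler0.
have -> : a x - b x = (a - b : bop R Z) (x - trunc F x) by rewrite bopB tF subr0.
apply: (le_trans (l2norm_le_opnorm _ _)); apply: ler_wpM2l; first exact: opnorm_ge0.
exact/hF/fsubset_refl.
Qed.

Lemma bop_ext_crd a b :
  (forall z w, crd (a (delta w)) z = crd (b (delta w)) z) -> a = b.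
Proof. by move=> h; apply: bop_ext => w; apply: ell2P. Qed.

Lemma inner_ext_delta a y v : (forall z, inner (a (delta z)) y = inner (delta z) v) ->
  forall x, inner (a x) y = inner x v.
Proof.
move=> h x; apply/eqP; rewrite -subr_eq0 -normc_eq0; apply/eqP.
apply: (@zero_of_le_eps (opnorm a * l2norm y + l2norm v)); first exact: normc_ge0.
move=> e e0; have [F hF] := trunc_cvg x e0; have {}hF := hF F (fsubset_refl F).
have tF : inner (a (trunc F x)) y = inner (trunc F x) v.
  rewrite /trunc bop_sum !inner_suml; apply: eq_bigr => z _.
  by rewrite bopZ !innerZl h.
have -> : inner (a x) y - inner x v =
   inner (a (x - trunc F x)) y - inner (x - trunc F x) v.
  by rewrite bopB !innerBl tF; ring.
apply: (le_trans (le_normcD _ _)); rewrite normcN mulrDl; apply: lerD.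
  apply: (le_trans (cauchy_schwarz _ _)); rewrite mulrAC.
  apply: ler_wpM2r; first exact: l2norm_ge0.
  by apply: (le_trans (l2norm_le_opnorm _ _)); rewrite ler_wpM2l// opnorm_ge0.
apply: (le_trans (cauchy_schwarz _ _)); rewrite mulrC.
by rewrite ler_wpM2l// l2norm_ge0.
Qed.

Lemma is_adjoint_sym a b : is_adjoint a b -> is_adjoint b a.
Proof. by move=> h x y; rewrite innerC -h -innerC. Qed.

Lemma is_adjoint_delta a b :
  (forall z w, crd (a (delta z)) w = cj (crd (b (delta w)) z)) -> is_adjoint a b.
Proof.
move=> h x y; apply: (inner_ext_delta (v := b y)) => z.
rewrite [LHS]innerC [RHS]innerC; congr cj.
apply/esym; apply: (inner_ext_delta (v := a (delta z))) => w.
by rewrite inner_deltal inner_deltar h cjK.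
Qed.

Lemma inner_disjoint x y : (forall z, crd x z = 0 \/ crd y z = 0) -> inner x y = 0.
Proof.
move=> h; apply: sums_to_unique (inner_sums _ _) _ => e e0; exists fset0 => F _.
rewrite big1_fset ?subrr ?normc0 ?(ltW e0)// => z _ _.
by case: (h z) => ->; rewrite ?cj0 ?mul0r ?mulr0.
Qed.

Lemma projection_norm a x : projection a -> l2norm (a x) ^+ 2 = complex.Re (inner (a x) x).
Proof.
by move=> [aa ad]; rewrite -Re_inner_self -ad -mul_bopE aa.
Qed.

Lemma le_of_sqr (s t : R) : 0 <= s -> 0 <= t -> s ^+ 2 <= t * s -> s <= t.
Proof.
move=> s0 t0; have [->//|sn0] := eqVneq s 0.
by rewrite expr2 ler_pM2r// lt_neqAle eq_sym sn0.
Qed.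

Lemma projection_norm_le a x : projection a -> l2norm (a x) <= l2norm x.
Proof.
move=> pa; apply: le_of_sqr; rewrite ?l2norm_ge0// projection_norm//.
by apply: (le_trans (Re_le_normc _)); rewrite mulrC; exact: cauchy_schwarz.
Qed.

(** A projection satisfies <a x, y> = <a x, a y>, so its matrix entries are controlled by the norms
    of its columns; this is how column bounds yield the ghost property. *)
Lemma projection_inner_le a x y : projection a ->
  normc (inner (a x) y) <= l2norm (a x) * l2norm (a y).
Proof.
move=> [aa ad]; rewrite -{1}aa mul_bopE ad; exact: cauchy_schwarz.
Qed.

Lemma opnorm_mul a b : opnorm (a * b) <= opnorm a * opnorm b.
Proof.
apply: opnorm_le => [|x]; first by rewrite mulr_ge0 ?opnorm_ge0.
rewrite mul_bopE; apply: (le_trans (l2norm_le_opnorm _ _)).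
by rewrite -mulrA ler_wpM2l ?opnorm_ge0// l2norm_le_opnorm.
Qed.

End operators.

Section partial_translations.
Context {R : realType} {Z : choiceType}.
Implicit Types (v : ell2 R Z) (a : bop R Z) (x y z w : Z) (F : {fset Z})
  (G H : set (Z * Z)) (B : set Z).

(** Graphs rather than functions: splitting, restricting and uniting partial bijections become set
    operations, as the gliding hump needs. *)
Definition partial_inj (G : set (Z * Z)) :=
  (forall x y y', G (x, y) -> G (x, y') -> y = y') /\
  (forall x x' y, G (x, y) -> G (x', y) -> x = x').

Definition transp (G : set (Z * Z)) : set (Z * Z) := [set p | G (p.2, p.1)].
Definition dg (B : set Z) : set (Z * Z) := [set p | p.1 = p.2 /\ B p.1].

Lemma pinj_transp G : partial_inj G -> partial_inj (transp G).
Proof.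
by move=> [h1 h2]; split=> [x y y'|x x' y]; [exact: h2|exact: h1].
Qed.

Lemma pinj_sub G H : H `<=` G -> partial_inj G -> partial_inj H.
Proof.
move=> HG [h1 h2]; split=> [x y y' /HG g /HG g'|x x' y /HG g /HG g'].
  exact: h1 g g'.
exact: h2 g g'.
Qed.

Lemma pinj_dg B : partial_inj (dg B).
Proof. by split=> [x y y' [/= <- _] [/= <-]|x x' y [/= -> _] [/= ->]]. Qed.

Lemma pinj1 x y : partial_inj [set (x, y)].
Proof. by split=> [u v v' [_ ->] [_ ->]|u u' v [-> _] [-> _]]. Qed.

Lemma partial_translation_exists G : partial_inj G -> exists a : bop R Z,
  (forall v x y, G (x, y) -> crd (a v) x = crd v y) /\
  (forall v x, (forall y, ~ G (x, y)) -> crd (a v) x = 0).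
Proof.
move=> [Gf Gi].
pose h x : option Z := if pselect (exists y, G (x, y)) is left e then Some (sval (cid e)) else None.
have h1 x y : G (x, y) -> h x = Some y.
  rewrite /h => Gxy; case: pselect => [e|[]]; last by exists y.
  by congr Some; apply: Gf Gxy; exact: svalP (cid e).
have h2 x : (forall y, ~ G (x, y)) -> h x = None.
  by rewrite /h => n; case: pselect => // -[y g]; case: (n y g).
have h3 x y : h x = Some y -> G (x, y).
  by rewrite /h; case: pselect => // e [<-]; exact: svalP (cid e).
pose f v x : R[i] := if h x is Some y then crd v y else 0.
have fle v F : \sum_(x <- F) normc (f v x) ^+ 2 <= l2norm v ^+ 2.
  rewrite (bigID (fun x => h x != None))/= [X in _ + X]big1 ?addr0; last first.
    by move=> x; rewrite negbK /f => /eqP ->; rewrite normc0 expr0n.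
  (* Reindexing along the partner map, injective where [h] is defined, turns the sum into a part of
     the squared norm of v. *)
  pose g x := odflt x (h x).
  have gi : {in [fset x in F | h x != None]%fset &, injective g}.
    move=> x x'; rewrite !inE /g => /andP[_].
    case Ex : (h x) => [y|//] _ /andP[_]; case Ex' : (h x') => [y'|//] _ /= yy.
    by move: yy Ex' => <- Ex'; exact: Gi (h3 _ _ Ex) (h3 _ _ Ex').
  apply: le_trans (sq_sum_le_norm v (g @` [fset x in F | h x != None])%fset).
  rewrite big_imfset//= big_fset/= le_eqVlt; apply/orP; left; apply/eqP.
  rewrite big_mkcond [RHS]big_mkcond/=; apply: eq_bigr => x _.
  by rewrite /f /g; case: (h x).
have exv v : exists y : ell2 R Z, forall z, crd y z = f v z.
  by have [y] := ell2_of_bounded_sums (fle v); exists y.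
have [T hT] := choice exv.
have Tb : T \in @bounded_linear R Z.
  rewrite -topredE; apply/asboolP; split.
    move=> k u v; apply: ell2P => z; rewrite crdD crdZ !hT /f.
    by case: (h z) => [y|]; rewrite ?crdD ?crdZ// mulr0 addr0.
  exists 1 => v; rewrite mul1r -(@ler_pXn2r _ 2) ?nnegrE ?l2norm_ge0//.
  apply: sqr_norm_le => F; under eq_bigr do rewrite hT; exact: fle.
exists (exist (fun f : ell2 R Z -> ell2 R Z => f \in @bounded_linear R Z) T Tb).
by split=> v x => [y Gxy|n]; rewrite /bop_fun/= hT /f ?(h1 _ _ Gxy) ?(h2 _ n).
Qed.

(* The partial isometry mapping [delta y] to [delta x] for [(x, y)] in [G]; junk value [0] if
   [G] is not a partial bijection. *)
Definition pt G : bop R Z := if pselect (partial_inj G) is left p then sval (cid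
  (partial_translation_exists p)) else 0.

Lemma crd_pt G v x y : partial_inj G -> G (x, y) -> crd (pt G v) x = crd v y.
Proof.
move=> p Gxy; rewrite /pt; case: pselect => // q.
by case: cid => /= a [+ _]; apply.
Qed.

Lemma crd_pt0 G v x : partial_inj G -> (forall y, ~ G (x, y)) -> crd (pt G v) x = 0.
Proof.
move=> p Gxy; rewrite /pt; case: pselect => // q.
by case: cid => /= a [_ +]; apply.
Qed.

Lemma crd_pt_delta G x y : partial_inj G ->
  crd (pt G (delta y)) x = (`[< G (x, y) >])%:R.
Proof.
move=> p; case: (asboolP (G (x, y))) => [g|n].
  by rewrite (crd_pt _ p g) crd_delta eqxx.
have [[y' g]|n'] := pselect (exists y', G (x, y')).
  rewrite (crd_pt _ p g) crd_delta.
  by case: eqP => // yy; move: g; rewrite yy.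
by rewrite crd_pt0// => y' g; apply: n'; exists y'.
Qed.

Lemma crd_dg B v x : crd (pt (dg B) v) x = if `[< B x >] then crd v x else 0.
Proof.
case: asboolP => [Bx|nB]; first by rewrite (@crd_pt _ _ _ x)//; exact: pinj_dg.
by rewrite crd_pt0//; [exact: pinj_dg|move=> y [_ /nB]].
Qed.

Lemma crd_pt1 x y v z : crd (pt [set (x, y)] v) z = if z == x then crd v y else 0.
Proof.
have [->|zx] := eqVneq z x; first by rewrite (@crd_pt _ _ _ y)//; exact: pinj1.
by rewrite crd_pt0//; [exact: pinj1|move=> w [/eqP]; rewrite (negPf zx)].
Qed.

Lemma pt1E x y v : pt [set (x, y)] v = crd v y *: delta x.
Proof.
apply: ell2P => z; rewrite crd_pt1 crdZ crd_delta.
by case: eqP; rewrite ?mulr1 ?mulr0.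
Qed.

Lemma pt_adjoint G : partial_inj G -> is_adjoint (pt G : bop R Z) (pt (transp G)).
Proof.
move=> p; apply: is_adjoint_delta => z w.
rewrite !crd_pt_delta//; last exact: pinj_transp.
by rewrite /transp/=; case: asboolP; rewrite ?cj1 ?cj0.
Qed.

Lemma transp_dg B : transp (dg B) = dg B.
Proof.
by apply/seteqP; split=> -[x y] [/= -> ?].
Qed.

Lemma transp1 x y : transp [set (x, y)] = [set (y, x)].
Proof. by apply/seteqP; split=> -[u v] [/= -> ->]. Qed.

Lemma ptU G H : partial_inj (G `|` H) -> (forall p, G p -> H p -> False) ->
  pt (G `|` H) = pt G + pt H :> bop R Z.
Proof.
move=> p dis; have pG := pinj_sub (@subsetUl _ G H) p.
have pH := pinj_sub (@subsetUr _ G H) p.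
apply: bop_ext_crd => z w; rewrite add_bopE crdD !crd_pt_delta//.
case: asboolP => [[g|h]|n].
- by case: asboolP => // _; case: asboolP => [/(dis _ g)//|]; rewrite addr0.
- by case: asboolP => [/dis/(_ h)//|_]; case: asboolP => //; rewrite add0r.
- case: asboolP => [g|_]; first by case: n; left.
  by case: asboolP => [g|_]; [case: n; right|rewrite addr0].
Qed.

Lemma pt_dg_projection B : projection (pt (dg B) : bop R Z).
Proof.
split; last by rewrite -{2}transp_dg; exact/pt_adjoint/pinj_dg.
by apply: bopP => v; apply: ell2P => z; rewrite mul_bopE !crd_dg; case: asboolP.
Qed.

Lemma ptTpt G : partial_inj G -> pt (transp G) * pt G = pt (dg [set y | exists x, G (x,
  y)]) :> bop R Z.
Proof.
move=> p; apply: bopP => v; apply: ell2P => y; rewrite mul_bopE crd_dg.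
case: asboolP => [[x g]|n].
  by rewrite (@crd_pt (transp G) _ _ x) ?(crd_pt _ p g)//; exact: pinj_transp.
by rewrite crd_pt0//; [exact: pinj_transp|move=> x g; apply: n; exists x].
Qed.

Lemma pt1_mul x y z : pt [set (x, y)] * pt [set (y, z)] = pt [set (x, z)] :> bop R Z.
Proof.
apply: bopP => v; rewrite mul_bopE !pt1E crdZ crd_delta eqxx.
by rewrite mulr1.
Qed.

(** Compression by matrix units reads off one entry in purely algebraic terms, so that entries can
    be compared through [Phi]. *)
Lemma pt1_corner x y x' y' a : pt [set (x, y)] * a * pt [set (y', x')] =
  crd (a (delta y')) y *: pt [set (x, x')].
Proof.
apply: bopP => v; rewrite !mul_bopE scale_bopE !pt1E bopZ crdZ scalerA.
by rewrite mulrC.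
Qed.

Lemma pt_dgT : pt (dg setT) = 1 :> bop R Z.
Proof. by apply: bopP => v; apply: ell2P => z; rewrite crd_dg asboolT. Qed.

End partial_translations.

(** * Finite propagation *)

Section roe.
Context {R : realType} {Z : metricType R}.
Implicit Types (a b c : bop R Z) (v u : ell2 R Z) (x y z : Z) (r s e : R).

Definition finprop r a := forall z w, crd (a (delta w)) z != 0 -> mdist z w <= r.

Lemma propagation_fp a : (propagation a < +oo)%E <-> exists r, finprop r a.
Proof.
split=> [aoo|[r ar]]; last first.
  apply: (@le_lt_trans _ _ r%:E); last exact: ltry.
  apply: ge_ereal_sup => _ [[z w] /= zw <-]; rewrite lee_fin.
  by apply: ar; rewrite -inner_deltar.
have h z w : crd (a (delta w)) z != 0 -> ((mdist z w)%:E <= propagation a)%E.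
  by move=> zw; apply: ereal_sup_ubound; exists (z, w) => //=; rewrite inner_deltar.
move: aoo h; case: (propagation a) => [r _ h|//|_ h].
  by exists r => z w /h.
by exists 0 => z w /h.
Qed.

Lemma roe_approx a : uniform_roe Z a <->
  forall e, 0 < e -> exists b r, finprop r b /\ opnorm (a - b) <= e.
Proof.
split=> [ca e e0|h B /nbhs_ballP[e e0 eB]].
  have e0' : (0 : R[i]) < rc e by rewrite -[0]rc0 ltcR.
  have [b [/propagation_fp[r br]]] := ca _ (nbhsx_ballx a (rc e) e0').
  rewrite -ball_normE /= => ab; exists b, r; split => //.
  by rewrite -rc_le ltW.
(* Balls have their radius in R[i]; positivity there means zero imaginary part and positive real
   part. *)
have [d d0 ed] : exists2 d : R, 0 < d & rc d < e.
  move: e0 => /=; case: (e) => x y /=; rewrite ltcE/= => /andP[/eqP -> x0].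
  exists (x / 2); first by rewrite divr_gt0.
  by rewrite ltcE/= eqxx/= ltr_pdivrMr// ltr_pMr// ltr1n.
have [b [r [br ab]]] := h _ d0; exists b; split; first by apply/propagation_fp; exists r.
apply: eB; rewrite -ball_normE/=; apply: le_lt_trans ed.
by rewrite -rc_le in ab.
Qed.

Lemma fp_roe r a : finprop r a -> uniform_roe Z a.
Proof.
move=> ar; apply/roe_approx => e e0; exists a, r; split => //.
rewrite subrr; apply: opnorm_le => [|x]; first exact: ltW.
by rewrite zero_bopE l2norm0 mulr_ge0 ?l2norm_ge0// ltW.
Qed.

Lemma fp_le r s a : r <= s -> finprop r a -> finprop s a.
Proof. by move=> rs ar z w /ar h; exact: le_trans rs. Qed.

Lemma fpD r a b : finprop r a -> finprop r b -> finprop r (a + b).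
Proof.
move=> ar br z w; rewrite add_bopE crdD; have [a0|/ar//] := eqVneq (crd (a (delta w)) z) 0.
by rewrite a0 add0r; exact: br.
Qed.

Lemma fpZ r k a : finprop r a -> finprop r (k *: a).
Proof.
move=> ar z w; rewrite scale_bopE crdZ; have [a0|/ar//] := eqVneq (crd (a (delta w)) z) 0.
by rewrite a0 mulr0 eqxx.
Qed.

Definition sep s v u := forall z z', crd v z != 0 -> crd u z' != 0 -> s < mdist z z'.

(** For finitely supported v the pairing vanishes term by term; truncation reaches the general
    case. *)
Lemma fp_sep r b v u : finprop r b -> sep r v u -> inner (b v) u = 0.
Proof.
move=> br vw; apply/eqP; rewrite -normc_eq0; apply/eqP.
apply: (@zero_of_le_eps _ (opnorm b * l2norm u)); first exact: normc_ge0.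
move=> e e0; have [F hF] := trunc_cvg v e0; have {}hF := hF F (fsubset_refl F).
have tF : inner (b (trunc F v)) u = 0.
  rewrite /trunc bop_sum inner_suml big1// => z _.
  have [->|vz] := eqVneq (crd v z) 0; first by rewrite scale0r bop0 inner0l.
  rewrite bopZ innerZl inner_disjoint ?mulr0// => z'.
  have [->|bz] := eqVneq (crd (b (delta z)) z') 0; [by left|right].
  apply/eqP/negPn/negP => uz; have := vw _ _ vz uz.
  by rewrite ltNge metric_sym (br _ _ bz).
rewrite -[inner (b v) u]subr0 -tF -innerBl -bopB.
apply: (le_trans (cauchy_schwarz _ _)); rewrite mulrAC.
apply: ler_wpM2r; first exact: l2norm_ge0.
by apply: (le_trans (l2norm_le_opnorm _ _)); rewrite ler_wpM2l// opnorm_ge0.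
Qed.

Lemma roe_quasilocal a e : uniform_roe Z a -> 0 < e ->
  exists s, forall v u, sep s v u -> normc (inner (a v) u) <= e * l2norm v * l2norm u.
Proof.
move=> /roe_approx h e0; have [b [r [br ab]]] := h _ e0.
exists r => v u /(fp_sep br) bvu.
rewrite -[inner _ _]subr0 -bvu -innerBl; apply: (le_trans (cauchy_schwarz _ _)).
apply: ler_wpM2r; first exact: l2norm_ge0.
apply: (le_trans (l2norm_le_opnorm (a - b) _)).
by apply: ler_wpM2r; first exact: l2norm_ge0.
Qed.

(** An entry of the product is an infinite sum; applying [fp_sep] to the column [b (delta w)] and to
    [delta z] avoids expanding it. *)
Lemma fpM r s a b : finprop r a -> finprop s b -> finprop (r + s) (a * b).
Proof.
move=> ar bs z w; rewrite mul_bopE leNgt; apply: contra => rs.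
apply/eqP; rewrite -inner_deltar; apply: (fp_sep ar) => y z' by0.
rewrite crd_delta; have [->{z'} _|_] := eqVneq z' z; last by rewrite eqxx.
rewrite ltNge; apply/negP => yz; move: rs; rewrite ltNge => /negP; apply.
by rewrite (le_trans (metric_triangle z y w))// lerD// ?(bs _ _ by0)// metric_sym.
Qed.

Lemma roeZD k a b : uniform_roe Z a -> uniform_roe Z b -> uniform_roe Z (k *: a + b).
Proof.
move=> /roe_approx ha /roe_approx hb; apply/roe_approx => e e0.
have k0 : 0 < normc k + 1 by rewrite ltr_wpDl// normc_ge0.
have e1 : 0 < e / 2 / (normc k + 1) by rewrite !divr_gt0.
have e2 : 0 < e / 2 by rewrite divr_gt0.
have [a' [r [ar aa]]] := ha _ e1; have [b' [s [bs bb]]] := hb _ e2.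
exists (k *: a' + b'), (Num.max r s); split.
  apply: fpD; last by apply: fp_le bs; rewrite le_max lexx orbT.
  by apply: fpZ; apply: fp_le ar; rewrite le_max lexx.
rewrite opprD addrACA -scalerBr; apply: (le_trans (opnormD _ _)).
rewrite (splitr e); apply: lerD => //; rewrite opnormZ.
apply: (@le_trans _ _ ((normc k + 1) * (e / 2 / (normc k + 1)))).
  by apply: ler_pM; rewrite ?normc_ge0 ?opnorm_ge0// lerDl.
by rewrite mulrC divfK ?gt_eqF.
Qed.

Lemma roe0 : uniform_roe Z (0 : bop R Z).
Proof. by apply: (@fp_roe 0) => z w; rewrite eqxx. Qed.

Lemma roeD a b : uniform_roe Z a -> uniform_roe Z b -> uniform_roe Z (a + b).
Proof. by move=> ha hb; rewrite -[a]scale1r; exact: roeZD. Qed.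

Lemma roeZ k a : uniform_roe Z a -> uniform_roe Z (k *: a).
Proof. by move=> ha; rewrite -[k *: a]addr0; apply: roeZD => //; exact: roe0. Qed.

Lemma roeN a : uniform_roe Z a -> uniform_roe Z (- a).
Proof. by move=> ha; rewrite -scaleN1r; exact: roeZ. Qed.

Lemma roeB a b : uniform_roe Z a -> uniform_roe Z b -> uniform_roe Z (a - b).
Proof. by move=> ha hb; apply: roeD => //; exact: roeN. Qed.

Lemma roeM a b : uniform_roe Z a -> uniform_roe Z b -> uniform_roe Z (a * b).
Proof.
move=> /roe_approx ha /roe_approx hb; apply/roe_approx => e e0.
have a0 : 0 < opnorm a + 1 by rewrite ltr_wpDl// opnorm_ge0.
have e1 : 0 < e / 2 / (opnorm a + 1) by rewrite !divr_gt0.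
have [b' [s [bs bb]]] := hb _ e1.
have b0 : 0 < opnorm b' + 1 by rewrite ltr_wpDl// opnorm_ge0.
have e2 : 0 < e / 2 / (opnorm b' + 1) by rewrite !divr_gt0.
have [a' [r [ar aa]]] := ha _ e2.
exists (a' * b'), (r + s); split; first exact: fpM.
have -> : a * b - a' * b' = a * (b - b') + (a - a') * b'.
  by rewrite mulrBr mulrBl addrA subrK.
apply: (le_trans (opnormD _ _)); rewrite (splitr e); apply: lerD.
  apply: (le_trans (opnorm_mul _ _)).
  apply: (@le_trans _ _ ((opnorm a + 1) * (e / 2 / (opnorm a + 1)))).
    by apply: ler_pM; rewrite ?opnorm_ge0// lerDl.
  by rewrite mulrC divfK ?gt_eqF.
apply: (le_trans (opnorm_mul _ _)).
apply: (@le_trans _ _ ((e / 2 / (opnorm b' + 1)) * (opnorm b' + 1))).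
  by apply: ler_pM; rewrite ?opnorm_ge0// lerDl.
by rewrite divfK ?gt_eqF.
Qed.

Definition within r (G : set (Z * Z)) := forall x y, G (x, y) -> mdist x y <= r.

Lemma pt_roe r G : within r G -> uniform_roe Z (pt G).
Proof.
move=> Gr; have [p|n] := pselect (partial_inj G); last first.
  by rewrite /pt; case: pselect => // _; exact: roe0.
apply: (@fp_roe r) => z w; rewrite crd_pt_delta//.
by case: asboolP => [/Gr//|_]; rewrite eqxx.
Qed.

Lemma dg_roe B : uniform_roe Z (pt (dg B)).
Proof. by apply: (@pt_roe 0) => x y [/= -> _]; rewrite mdistxx. Qed.

Lemma pt1_roe x y : uniform_roe Z (pt [set (x, y)]).
Proof. by apply: (@pt_roe (mdist x y)) => u v [-> ->]. Qed.

Lemma roe1 : uniform_roe Z (1 : bop R Z).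
Proof. by rewrite -pt_dgT; exact: dg_roe. Qed.

Hypothesis ulf : uniformly_locally_finite Z.

Lemma ball_finite z r : finite_set [set w | mdist z w <= r].
Proof.
have [r0|r0] := leP 0 r.
  by have [n hn] := ulf r0; exact: card_le_finite (hn z) (finite_II n).
rewrite (_ : [set w | _] = set0)//; apply/seteqP; split=> // w /= /le_lt_trans/(_ r0).
by rewrite ltNge mdist_ge0.
Qed.

Lemma ball_fset z r : exists B : {fset Z}, forall w, (w \in B) = (mdist z w <= r).
Proof.
exists (fset_set [set w | mdist z w <= r]) => w.
rewrite in_fset_set; last exact: ball_finite.
by apply/idP/idP => [/set_mem|/mem_set].
Qed.

End roe.

(** * Gliding hump *)

Section gliding_hump.
Context {R : realType} {S Z : metricType R}.
(** [T] stands for two families: [Phi (pt G)] for partial translations of X and, with the two spaces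
    exchanged, the preimages under [Phi] of the compressed partial translations of Y. *)
Variables (r : R) (T : set (S * S) -> bop R Z).
Implicit Types (v u : ell2 R Z) (F : {fset S}) (G H : set (S * S)) (e s : R).

Definition ptrans G := partial_inj G /\ within r G.

Lemma ptrans_sub G H : H `<=` G -> ptrans G -> ptrans H.
Proof. by move=> HG [p b]; split; [exact: pinj_sub p|move=> x y /HG/b]. Qed.

Definition avoids F G := forall x y, G (x, y) -> x \notin F /\ y \notin F.
Definition inside F G := forall x y, G (x, y) -> x \in F /\ y \in F.
Definition fsupp v := exists F : {fset Z}, forall z, z \notin F -> crd v z = 0.

Hypothesis ulf : uniformly_locally_finite S.
Hypothesis T_roe : forall G, ptrans G -> uniform_roe Z (T G).
Hypothesis T_add : forall G H, ptrans (G `|` H) -> (forall p, G p -> H p -> False) ->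
  T (G `|` H) = T G + T H.
(** A weak substitute for strong continuity: pairs far out act weakly on each basis vector,
    uniformly in G, so the tail of an infinite union can be neglected. *)
Hypothesis T_cont : forall z e, 0 < e -> exists F, forall G, ptrans G -> avoids F G ->
  l2norm (T G (delta z)) <= e.

Lemma sep_le s s' v u : s <= s' -> sep s' v u -> sep s v u.
Proof. by move=> ss h z z' vz uz; apply: le_lt_trans ss _; exact: h. Qed.

Lemma T_set0 : T set0 = 0.
Proof.
have p0 : ptrans (set0 `|` set0) by rewrite setU0; split; [split|]; move=> x y.
have := T_add p0 (fun p (h : set0 p) => False_ind _ h); rewrite setU0.
by move=> h; apply: (addrI (T set0)); rewrite -h addr0.
Qed.

Lemma T_cont_fsupp v e : fsupp v -> 0 < e -> exists F, forall G, ptrans G -> avoids F G ->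
  l2norm (T G v) <= e.
Proof.
move=> [K vK]; have -> : v = trunc K v.
  by apply: ell2P => z; rewrite crd_trunc; case: ifPn => // /vK.
rewrite /trunc; elim: (enum_fset K) e => [|z l IH] e e0.
  by exists fset0 => G _ _; rewrite big_nil bop0 l2norm0 ltW.
have c0 : 0 < normc (crd v z) + 1 by rewrite ltr_wpDl// normc_ge0.
have [F1 h1] := T_cont z (divr_gt0 (divr_gt0 e0 (ltr0Sn _ 1)) c0).
have [F2 h2] := IH _ (divr_gt0 e0 (ltr0Sn _ 1)).
exists (F1 `|` F2)%fset => G gG aG; rewrite big_cons bopD bopZ.
apply: (le_trans (l2normD _ _)); rewrite [leRHS]splitr; apply: lerD.
  rewrite l2normZ; apply: (@le_trans _ _ ((normc (crd v z) + 1) * (e / 2 / (normc (crd v z) + 1)))).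
    apply: ler_pM; rewrite ?normc_ge0 ?l2norm_ge0// ?lerDl// h1// => x y /aG.
    by rewrite !inE !negb_or => -[/andP[-> _] /andP[-> _]].
  by rewrite mulrC divfK ?gt_eqF.
apply: h2 => // x y /aG.
by rewrite !inE !negb_or => -[/andP[_ ->] /andP[_ ->]].
Qed.

(** Induction peels off one pair at a time by additivity, halving the tolerance, and uses the
    quasi-locality of each single [T [set p]]. *)
Lemma uniform_sep_list (l : seq (S * S)) e : 0 < e -> exists s, forall H, ptrans H ->
  (forall p, H p -> p \in l) -> forall v u, sep s v u ->
  normc (inner (T H v) u) <= e * (l2norm v * l2norm u).
Proof.
elim: l e => [|p l IH] e e0.
  exists 0 => H _ Hl v u _; have -> : H = set0 by apply/seteqP; split=> // p /Hl.
  by rewrite T_set0 inner0l normc0 !mulr_ge0 ?l2norm_ge0// ltW.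
have e2 : 0 < e / 2 by rewrite divr_gt0.
have [s1 h1] := IH _ e2.
have [s2 h2] : exists s, ptrans [set p] -> forall v u, sep s v u ->
    normc (inner (T [set p] v) u) <= e / 2 * (l2norm v * l2norm u).
  have [pp|np] := pselect (ptrans [set p]); last by exists 0.
  have [s hs] := roe_quasilocal (T_roe pp) e2.
  by exists s => _ v u /hs; rewrite mulrA.
exists (Num.max s1 s2) => H gH Hl v u vu.
have [Hp|nHp] := pselect (H p); last first.
  have Hl' q : H q -> q \in l.
    by move=> Hq; have := Hl _ Hq; rewrite inE => /orP[/eqP qp|//]; case: nHp; rewrite -qp.
  apply: le_trans (h1 H gH Hl' v u _) _.
    by apply: sep_le vu; rewrite le_max lexx.
  by rewrite ler_wpM2r ?mulr_ge0 ?l2norm_ge0// ler_pdivrMr// ler_pMr// ler1n.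
have HE : H = [set p] `|` (H `\ p).
  apply/seteqP; split=> [q Hq|q [->|[]]//].
  by have [->|qp] := eqVneq q p; [left|right; split => //; apply/eqP].
rewrite HE T_add; last 2 first.
- by rewrite -HE.
- by move=> q -> [_ /=].
rewrite add_bopE innerDl (splitr e) mulrDl; apply: (le_trans (le_normcD _ _)).
apply: lerD.
  apply: h2; first by apply: ptrans_sub gH => q ->.
  by apply: sep_le vu; rewrite le_max lexx orbT.
apply: h1; first by apply: ptrans_sub gH => q [].
  by move=> q [/Hl + /= /eqP qp]; rewrite inE (negPf qp).
by apply: sep_le vu; rewrite le_max lexx.
Qed.

(** By local finiteness only finitely many pairs of displacement at most r touch F, and these are
    enumerated in one list. *)
Lemma uniform_sep_touching F e : 0 < e -> exists s, forall H, ptrans H ->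
  (forall x y, H (x, y) -> x \in F \/ y \in F) -> forall v u, sep s v u ->
  normc (inner (T H v) u) <= e * (l2norm v * l2norm u).
Proof.
move=> e0; have [B hB] := choice (fun x => ball_fset ulf x r).
pose l := [seq (x, y) | x <- enum_fset F, y <- enum_fset (B x)] ++
          [seq (y, x) | x <- enum_fset F, y <- enum_fset (B x)].
have [s hs] := uniform_sep_list l e0; exists s => H gH HF v u vu.
apply: hs => // -[x y] Hxy; have xy := gH.2 _ _ Hxy.
rewrite mem_cat; apply/orP; case: (HF _ _ Hxy) => [xF|yF]; [left|right].
  by apply/allpairsPdep; exists x, y; split; rewrite ?hB.
by apply/allpairsPdep; exists y, x; split; rewrite ?hB// metric_sym.
Qed.

(** Pairs touching F account for at most e/8 of a counterexample of size e, so the hump left after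
    discarding them still exceeds e/2. The set F' contains this hump and makes everything beyond it
    negligible on the vector v. *)
Lemma hump_step F (n : nat) e : 0 < e ->
  (forall s, exists G v u, [/\ ptrans G, (exists F, inside F G), fsupp v, sep s v u &
     e * (l2norm v * l2norm u) < normc (inner (T G v) u)]) ->
  exists (G : set (S * S)) (vu : ell2 R Z * ell2 R Z) (F' : {fset S}),
  [/\ [/\ ptrans G, avoids F G, inside F' G & (F `<=` F')%fset],
     sep n%:R vu.1 vu.2,
     (forall H, ptrans H -> inside F H ->
       normc (inner (T H vu.1) vu.2) <= e / 8 * (l2norm vu.1 * l2norm vu.2)),
     (forall H, ptrans H -> avoids F' H -> l2norm (T H vu.1) <= e / 8 * l2norm vu.1) &
     0 < l2norm vu.1 * l2norm vu.2 /\
     e / 2 * (l2norm vu.1 * l2norm vu.2) < normc (inner (T G vu.1) vu.2)].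
Proof.
move=> e0 h; have e8 : 0 < e / 8 by rewrite divr_gt0.
have [s0 hs0] := uniform_sep_touching F e8.
have [G0 [v [u [gG0 [F0 iF0] fv vu big]]]] := h (Num.max s0 n%:R).
have vu0 : 0 < l2norm v * l2norm u.
  have [v0|v0] := eqVneq v 0.
    by move: big; rewrite v0 bop0 inner0l normc0 l2norm0 mul0r mulr0 ltxx.
  have [u0|u0] := eqVneq u 0.
    by move: big; rewrite u0 inner0r normc0 l2norm0 !mulr0 ltxx.
  by rewrite mulr_gt0// l2norm_gt0.
have v0 : 0 < l2norm v.
  by rewrite lt_neqAle l2norm_ge0 andbT eq_sym; apply/eqP => v0; move: vu0; rewrite v0 mul0r ltxx.
pose H0 := [set p : S * S | G0 p /\ (p.1 \in F \/ p.2 \in F)].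
pose G1 := [set p : S * S | G0 p /\ ~ (p.1 \in F \/ p.2 \in F)].
have GE : G0 = G1 `|` H0.
  apply/seteqP; split=> [p Gp|p [[]|[]]//].
  by have [pF|pF] := pselect (p.1 \in F \/ p.2 \in F); [right|left].
have [F1 hF1] := T_cont_fsupp fv (mulr_gt0 e8 v0).
exists G1, (v, u), (F `|` F0 `|` F1)%fset; split => /=.
- split.
  + by apply: ptrans_sub gG0 => p [].
  + by move=> x y [_ /= /not_orP[/negP ? /negP ?]].
  + by move=> x y [/iF0[xF yF] _]; rewrite !inE xF yF !orbT.
  + by rewrite -fsetUA; exact: fsubsetUl.
- by apply: sep_le vu; rewrite le_max lexx orbT.
- move=> H gH iH; apply: hs0 => //; first by move=> x y /iH[]; left.
  by apply: sep_le vu; rewrite le_max lexx.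
- move=> H gH aH; apply: hF1 => // x y /aH.
  by rewrite !inE !negb_or => -[/andP[_ ->] /andP[_ ->]].
split=> //; rewrite -[X in _ < X]/(normc (inner (T G1 v) u)).
move: big; rewrite GE T_add; last 2 first.
- by rewrite -GE.
- by move=> p [_ np] [_].
rewrite add_bopE innerDl => big.
have hH : normc (inner (T H0 v) u) <= e / 8 * (l2norm v * l2norm u).
  apply: hs0; first by apply: ptrans_sub gG0 => p [].
    by move=> x y [].
  by apply: sep_le vu; rewrite le_max lexx.
move: (mulr_gt0 e0 vu0); move: hH big (le_normcD (inner (T G1 v) u) (inner (T H0 v) u)).
by move: (normc _) (normc _) (normc _) (l2norm v * l2norm u) => *; lra.
Qed.

(** Otherwise infinitely many disjoint humps exist at growing separations. Their union is again a
    partial translation, so a single operator in the Roe algebra would fail to be quasi-local. *)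
Lemma gliding_hump e : 0 < e -> exists s, forall G, ptrans G -> (exists F, inside F G) ->
  forall v u, fsupp v -> sep s v u -> normc (inner (T G v) u) <= e * (l2norm v * l2norm u).
Proof.
move=> e0; apply: contrapT => no.
have {}no s : exists G v u, [/\ ptrans G, (exists F, inside F G), fsupp v, sep s v u &
     e * (l2norm v * l2norm u) < normc (inner (T G v) u)].
  apply: contrapT => no'; apply: no; exists s => G gG iG v u fv vu.
  by rewrite leNgt; apply/negP => big; apply: no'; exists G, v, u.
have step (q : {fset S} * nat) := hump_step q.1 q.2 e0 no.
have [G_ {}step] := choice step; have [vu_ {}step] := choice step.
have [F_ {}step] := choice step.
pose fix Fs n := if n is m.+1 then F_ (Fs m, m) else fset0.
pose G n := G_ (Fs n, n); pose vu n := vu_ (Fs n, n).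
have st n : [/\ [/\ ptrans (G n), avoids (Fs n) (G n),
  inside (Fs n.+1) (G n) & (Fs n `<=` Fs n.+1)%fset],
     sep n%:R (vu n).1 (vu n).2,
     (forall H, ptrans H -> inside (Fs n) H ->
       normc (inner (T H (vu n).1) (vu n).2) <= e / 8 * (l2norm (vu n).1 * l2norm (vu n).2)),
     (forall H, ptrans H -> avoids (Fs n.+1) H ->
       l2norm (T H (vu n).1) <= e / 8 * l2norm (vu n).1) &
     0 < l2norm (vu n).1 * l2norm (vu n).2 /\
     e / 2 * (l2norm (vu n).1 * l2norm (vu n).2) < normc (inner (T (G n) (vu n).1) (vu n).2)].
  exact: (step (Fs n, n)).
have Fmono m n : (m <= n)%N -> (Fs m `<=` Fs n)%fset.
  elim: n => [|n IH]; first by rewrite leqn0 => /eqP ->.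
  rewrite leq_eqVlt => /orP[/eqP ->//|/IH mn].
  by apply: (fsubset_trans mn); have [[]] := st n.
have ins m n : (m < n)%N -> inside (Fs n) (G m).
  move=> mn x y; have [[_ _ + _] _ _ _ _] := st m => /[apply] -[xF yF].
  by split; apply: (fsubsetP (Fmono _ _ mn)).
have avo m n : (m <= n)%N -> avoids (Fs m) (G n).
  move=> mn x y; have [[_ + _ _] _ _ _ _] := st n => /[apply] -[xF yF].
  by split; [apply: contra xF|apply: contra yF]; exact: (fsubsetP (Fmono _ _ mn)).
pose Ginf := [set p | exists n, G n p].
(* Each hump lies in a finite set that all later ones avoid, so two pairs sharing a coordinate come
   from the same hump; this makes the union a partial bijection and its pieces disjoint. *)
have uniq1 n m x y x' y' : G n (x, y) -> G m (x', y') -> x = x' \/ y = y' -> n = m.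
  move=> gn gm xy; case: (ltngtP n m) => // nm.
    have [xF yF] := ins _ _ nm _ _ gn; have [xF' yF'] := avo _ _ (leqnn m) _ _ gm.
    by case: xy => E; [move: xF'|move: yF']; rewrite -E ?xF ?yF.
  have [xF yF] := ins _ _ nm _ _ gm; have [xF' yF'] := avo _ _ (leqnn n) _ _ gn.
  by case: xy => E; [move: xF'|move: yF']; rewrite E ?xF ?yF.
have ginf : ptrans Ginf.
  split; [split|].
  - move=> x y y' [n gn] [m gm]; have E := uniq1 _ _ _ _ _ _ gn gm (or_introl erefl).
    by move: gm; rewrite -E => gm; have [[[[+ _] _] _ _ _] _ _ _ _] := st n; apply; eauto.
  - move=> x y y' [n gn] [m gm]; have E := uniq1 _ _ _ _ _ _ gn gm (or_intror erefl).
    by move: gm; rewrite -E => gm; have [[[[_ +] _] _ _ _] _ _ _ _] := st n; apply; eauto.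
  - by move=> x y [n gn]; have [[[_ +] _ _ _] _ _ _ _] := st n; apply.
have e8 : 0 < e / 8 by rewrite divr_gt0.
have [s hs] := roe_quasilocal (T_roe ginf) e8.
pose n := Num.bound `|s|.
have sn : s <= n%:R by apply: (le_trans (ler_norm _)); apply/ltW/archi_boundP.
have [[gn an inn _] vun h1 h2 [vu0 big]] := st n.
have := hs _ _ (sep_le sn vun).
pose L := [set p | exists2 m, (m < n)%N & G m p].
pose U := [set p | exists2 m, (n < m)%N & G m p].
have GE : Ginf = L `|` (G n `|` U).
  apply/seteqP; split=> [p [m gm]|p [[m _ gm]|[gm|[m _ gm]]]]; last 3 first.
  - by exists m.
  - by exists n.
  - by exists m.
  case: (ltngtP m n) => nm; first by left; exists m.
    by right; right; exists m.
  by right; left; rewrite -nm.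
have gL : ptrans L by apply: ptrans_sub ginf => p [m _ gm]; exists m.
have gU : ptrans U by apply: ptrans_sub ginf => p [m _ gm]; exists m.
have gGU : ptrans (G n `|` U) by apply: ptrans_sub ginf => p gp; rewrite GE; right.
have -> : T Ginf = T L + (T (G n) + T U).
  rewrite GE T_add; last 2 first.
  - by rewrite -GE.
  - move=> [x y] [m mn gm] [gp|[m' nm' gp]].
      by have E := uniq1 _ _ _ _ _ _ gm gp (or_introl erefl); rewrite E ltnn in mn.
    have E := uniq1 _ _ _ _ _ _ gm gp (or_introl erefl).
    by have := ltn_trans mn nm'; rewrite E ltnn.
  congr (_ + _); rewrite T_add// => -[x y] gp [m nm gm].
  by have E := uniq1 _ _ _ _ _ _ gm gp (or_introl erefl); rewrite E ltnn in nm.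
rewrite !add_bopE !innerDl.
have hL : normc (inner (T L (vu n).1) (vu n).2) <= e / 8 * (l2norm (vu n).1 * l2norm (vu n).2).
  by apply: h1 => // x y [m mn gm]; exact: ins gm.
have hU : normc (inner (T U (vu n).1) (vu n).2) <= e / 8 * (l2norm (vu n).1 * l2norm (vu n).2).
  apply: (le_trans (cauchy_schwarz _ _)); rewrite mulrA ler_wpM2r ?l2norm_ge0//.
  by apply: h2 => // x y [m nm gm]; exact: avo gm.
set a := inner (T L _) _ in hL *; set c := inner (T U _) _ in hU *.
set b := inner (T (G n) _) _ in big *; move=> habc.
(* The total is at most e/8 by quasi-locality of [T Ginf], and the earlier and later humps
   contribute at most e/8 each: this leaves 3e/8 for a term exceeding e/2. *)
have : normc b <= normc (a + (b + c)) + (normc a + normc c).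
  have Eb : b = (a + (b + c)) + (- a - c) by ring.
  have E := le_normcD (a + (b + c)) (- a - c).
  have E' := le_normcD (- a) (- c); rewrite !normcN in E'.
  by rewrite {1}Eb; apply: (le_trans E); apply: lerD.
rewrite -mulrA in habc; move: big hL hU habc (mulr_gt0 e0 vu0).
by move: (normc _) (normc _) (normc _) (normc _) (_ * l2norm _) => *; lra.
Qed.

End gliding_hump.

(** * The orthonormal frame implementing Phi *)

Section orthonormal.
Context {R : realType} {X Y : choiceType}.
Variable u : X -> ell2 R Y.
Hypothesis ortho : forall x x', inner (u x) (u x') = (x == x')%:R.
Implicit Types (F : {fset X}) (v : ell2 R Y).

Lemma inner_ortho_sum F (k : X -> R[i]) x : x \in F ->
  inner (\sum_(z <- F) k z *: u z) (u x) = k x.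
Proof.
move=> xF; rewrite inner_suml (big_fsetD1 x)//= innerZl ortho eqxx mulr1.
rewrite big1_fset ?addr0// => z; rewrite !inE => /andP[zx _] _.
by rewrite innerZl ortho (negPf zx) mulr0.
Qed.

Lemma norm_ortho_sum F (k : X -> R[i]) :
  l2norm (\sum_(z <- F) k z *: u z) ^+ 2 = \sum_(z <- F) normc (k z) ^+ 2.
Proof.
apply: rc_inj; rewrite -inner_self inner_sumr rc_sum big_seq [RHS]big_seq.
by apply: eq_bigr => z zF; rewrite innerZr inner_ortho_sum// rc_sqr_normc mulrC.
Qed.

Lemma bessel v F : \sum_(x <- F) normc (inner v (u x)) ^+ 2 <= l2norm v ^+ 2.
Proof.
pose w := \sum_(x <- F) inner v (u x) *: u x.
have vw : inner v w = rc (l2norm w ^+ 2).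
  rewrite norm_ortho_sum rc_sum inner_sumr; apply: eq_bigr => z _.
  by rewrite innerZr rc_sqr_normc mulrC.
have : 0 <= l2norm (v - w) ^+ 2 by rewrite sqr_ge0.
have -> : l2norm (v - w) ^+ 2 = l2norm v ^+ 2 - l2norm w ^+ 2.
  apply: rc_inj; rewrite -inner_self innerBl !innerBr (innerC v w) vw cj_rc.
  by rewrite !inner_self rcB; ring.
by rewrite subr_ge0 (norm_ortho_sum F (fun x => inner v (u x))).
Qed.

End orthonormal.

Section tails.
Context {R : realType} {X : choiceType}.

Lemma tail_small (f : X -> R) (c e : R) : (forall x, 0 <= f x) ->
  (forall F : {fset X}, \sum_(x <- F) f x <= c) -> 0 < e ->
  exists F : {fset X}, forall E : {fset X}, (forall x, x \in E -> x \notin F) ->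
    \sum_(x <- E) f x <= e.
Proof.
move=> f0 fc e0.
have foo : (\esum_(z in [set: X]) (f z)%:E < +oo)%E.
  by apply: (@le_lt_trans _ _ c%:E); [exact: esum_le_fset|exact: ltry].
have [F hF] := esum_fset_ex e0 f0 foo; exists F => E EF.
have := esum_fset_le (E `|` F)%fset f0 foo.
rewrite (big_fsetID _ (mem E) (E `|` F)%fset)/=.
rewrite (_ : [fset x in (E `|` F)%fset | x \in E]%fset = E); last first.
  by apply/fsetP => x; rewrite !inE; case: (x \in E); rewrite ?andbF.
rewrite (_ : [fset x in (E `|` F)%fset | x \notin E]%fset = F); last first.
  apply/fsetP => x; rewrite !inE; case: (boolP (x \in E)) => [/EF/negPf ->|_] //=.
  by rewrite andbT.
by move: hF; move: (fine _) => s; lra.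
Qed.

End tails.

Lemma cj_real {R : realType} (z : R[i]) : cj z = z -> z = rc (complex.Re z).
Proof.
case: z => x y [] /eqP; rewrite eq_sym -addr_eq0 -mulr2n mulrn_eq0/= => /eqP ->.
by [].
Qed.

Section spatial.
Context {R : realType} {X Y : metricType R}.
Variable Phi : bop R X -> bop R Y.
Hypothesis PhiH : star_homomorphism (uniform_roe X) (uniform_roe Y) Phi.
Hypothesis Phi_inj : set_inj (uniform_roe X) Phi.
Hypothesis Phi_her : hereditary (uniform_roe Y) (Phi @` uniform_roe X).
Implicit Types (a b : bop R X) (v w : ell2 R Y) (x : X) (y : Y) (B : set X).

Lemma Phi_roe a : uniform_roe X a -> uniform_roe Y (Phi a).
Proof. by case: PhiH => + _ _ _; apply. Qed.

Lemma PhiM a b : uniform_roe X a -> uniform_roe X b -> Phi (a * b) = Phi a * Phi b.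
Proof. by case: PhiH => _ _ + _; apply. Qed.

Lemma Phi_adjoint a b : uniform_roe X a -> uniform_roe X b ->
  is_adjoint a b -> is_adjoint (Phi a) (Phi b).
Proof. by case: PhiH => _ _ _; apply. Qed.

Lemma PhiD a b : uniform_roe X a -> uniform_roe X b -> Phi (a + b) = Phi a + Phi b.
Proof.
by case: PhiH => _ lin _ _ ha hb; have := lin 1 a b ha hb; rewrite !scale1r.
Qed.

Lemma Phi0 : Phi 0 = 0.
Proof. by apply: (addrI (Phi 0)); rewrite -PhiD ?addr0//; exact: roe0. Qed.

Lemma PhiZ k a : uniform_roe X a -> Phi (k *: a) = k *: Phi a.
Proof.
by case: PhiH => _ lin _ _ ha; have := lin k a 0 ha (@roe0 _ _); rewrite Phi0 !addr0.
Qed.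

Lemma Phi_injE a b : uniform_roe X a -> uniform_roe X b -> Phi a = Phi b -> a = b.
Proof. by move=> ha hb; apply: Phi_inj; apply/mem_set. Qed.

Definition prj B := Phi (pt (dg B)).

Lemma prj_roe B : uniform_roe Y (prj B).
Proof. exact/Phi_roe/dg_roe. Qed.

Lemma prj_projection B : projection (prj B).
Proof.
have [pp pa] := @pt_dg_projection R X B; split.
  by rewrite /prj -PhiM ?pp//; exact: dg_roe.
by apply: Phi_adjoint => //; exact: dg_roe.
Qed.

(** With p = [prj B], the operator p e_yy p lies between 0 and p because |<v, p delta_y>| = |<p v,
    delta_y>| <= |p v|; heredity then gives a preimage. *)
Lemma rank_one_in_range B y : exists2 b, uniform_roe X b &
  forall v, Phi b v = inner v (prj B (delta y)) *: prj B (delta y).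
Proof.
have [pp pa] := prj_projection B; set p := prj B in pp pa *.
pose t : bop R Y := p * pt [set (y, y)] * p.
have tE v : t v = inner v (p (delta y)) *: p (delta y).
  by rewrite /t !mul_bopE pt1E bopZ -inner_deltar pa.
have rt : uniform_roe Y t.
  by apply: roeM; [apply: roeM; [exact: prj_roe|exact: pt1_roe]|exact: prj_roe].
have [b rb Pb] : (Phi @` uniform_roe X) t.
  apply: (@Phi_her t p) => //.
  - by exists (pt (dg B)) => //; exact: dg_roe.
  - move=> v; rewrite tE innerZl (innerC v) -rc_sqr_normc -[0]rc0 rc_le.
    by rewrite sqr_ge0.
  - move=> v; rewrite add_bopE opp_bopE tE innerBl innerZl (innerC v (p (delta y))) -rc_sqr_normc.
    rewrite -{1}pp mul_bopE pa inner_self -rcB -[0]rc0 rc_le subr_ge0.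
    rewrite ler_pXn2r ?nnegrE ?normc_ge0 ?l2norm_ge0// -pa.
    by apply: (le_trans (cauchy_schwarz _ _)); rewrite l2norm_delta mulr1.
by exists b => // v; rewrite Pb tE.
Qed.

(** Let p be the image of one diagonal matrix unit. A rank one operator below p has a preimage b,
    which injectivity places in the one-dimensional corner cut out by that matrix unit; hence p
    itself has rank one. A unit vector in its range is then transported by the images of the matrix
    units [e x x0]. *)
Lemma frame_exists : exists u : X -> ell2 R Y,
  (forall x x' v, Phi (pt [set (x, x')]) v = inner v (u x') *: u x) /\
  (forall x x', inner (u x) (u x') = (x == x')%:R).
Proof.
have [[x0 _]|noX] := pselect (exists x : X, True); last first.
  by exists (fun=> 0); split=> x; case: noX; exists x.
pose e x x' : bop R X := pt [set (x, x')].
have re x x' : uniform_roe X (e x x') by exact: pt1_roe.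
have adj x x' : is_adjoint (Phi (e x x')) (Phi (e x' x)).
  by apply: Phi_adjoint => //; have := @pt_adjoint R _ _ (pinj1 x x'); rewrite transp1.
have dg0 : dg [set x0] = [set (x0, x0)].
  by apply/seteqP; split=> -[a b] [/= -> ->].
have [pp pa] := prj_projection [set x0].
have [y vy] : exists y, prj [set x0] (delta y) != 0.
  apply: contrapT => no.
  have P0 : Phi (e x0 x0) = Phi 0.
    rewrite Phi0; apply: bop_ext => y; apply/eqP/negPn/negP => h.
    by apply: no; exists y; rewrite /prj dg0.
  have := Phi_injE (re x0 x0) (@roe0 _ _) P0.
  move=> /(congr1 (fun a : bop R X => crd (a (delta x0)) x0)).
  rewrite /e crd_pt1 eqxx crd_delta eqxx zero_bopE crd_0 => /eqP.
  by rewrite oner_eq0.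
have [b rb Pb] := rank_one_in_range [set x0] y.
set p := prj [set x0] in pp pa vy Pb; set v := p (delta y) in vy Pb.
have pE : p = Phi (e x0 x0) by rewrite /p /prj dg0.
have pv : p v = v by rewrite /v -mul_bopE pp.
have bE : b = crd (b (delta x0)) x0 *: e x0 x0.
  rewrite -pt1_corner; apply: Phi_injE => //.
    by apply: roeM; [apply: roeM|]; try exact: pt1_roe.
  rewrite -!/(e _ _) (PhiM (roeM (re _ _) rb) (re _ _)) (PhiM (re _ _) rb) -pE.
  apply: bopP => w.
  by rewrite !mul_bopE !Pb bopZ pv pa pv.
set lam := crd _ _ in bE.
have Pl w : inner w v *: v = lam *: p w by rewrite -Pb bE PhiZ// pE.
have nv : 0 < l2norm v by rewrite l2norm_gt0.
have lamE : lam = rc (l2norm v ^+ 2).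
  have := Pl v; rewrite pv inner_self => /eqP; rewrite -subr_eq0 -scalerBl.
  by rewrite scaler_eq0 (negPf vy) orbF subr_eq0 => /eqP.
pose k := rc (l2norm v)^-1; pose u0 := k *: v.
have kk : k * cj k * lam = 1.
  rewrite cj_rc lamE -!rcM -rc1; congr rc; field; exact: lt0r_neq0.
have pu w : p w = inner w u0 *: u0.
  rewrite innerZr /u0 scalerA.
  have -> : cj k * inner w v * k = k * cj k * inner w v by ring.
  by rewrite -scalerA Pl scalerA kk scale1r.
have pu0 : p u0 = u0 by rewrite bopZ pv.
have nu0 : inner u0 u0 = 1.
  by rewrite innerZl innerZr inner_self -lamE mulrA kk.
exists (fun x => Phi (e x x0) u0); split=> [x x' w|x x'].
  have -> : pt [set (x, x')] = e x x0 * (e x0 x0 * e x0 x') by rewrite /e !pt1_mul.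
  rewrite PhiM ?PhiM//; last exact: roeM.
  rewrite !mul_bopE -pE pu bopZ; congr (_ *: _).
  exact: adj.
rewrite adj -mul_bopE -PhiM//.
have [<-|xx] := eqVneq x x'.
  rewrite /e pt1_mul; have := adj x0 x0 u0 u0.
  by rewrite /e -pE pu0 nu0.
rewrite (_ : e x0 x * e x' x0 = 0) ?Phi0 ?inner0r// /e.
apply: bopP => w; rewrite mul_bopE !pt1E zero_bopE crdZ crd_delta (negPf xx).
by rewrite mulr0 scale0r.
Qed.

End spatial.

Section with_frame.
Context {R : realType} {X Y : metricType R}.
Variable Phi : bop R X -> bop R Y.
Hypothesis PhiH : star_homomorphism (uniform_roe X) (uniform_roe Y) Phi.
Hypothesis Phi_inj : set_inj (uniform_roe X) Phi.
Hypothesis Phi_her : hereditary (uniform_roe Y) (Phi @` uniform_roe X).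
Variable u : X -> ell2 R Y.
Hypothesis PhiE : forall x x' v, Phi (pt [set (x, x')]) v = inner v (u x') *: u x.
Hypothesis ortho : forall x x', inner (u x) (u x') = (x == x')%:R.
Implicit Types (a b : bop R X) (v w : ell2 R Y) (x : X) (y : Y) (B : set X).
Let prj := prj Phi.

Lemma norm_frame x : l2norm (u x) = 1.
Proof.
apply/eqP; rewrite -(@eqrXn2 _ 2) ?l2norm_ge0// expr1n; apply/eqP/rc_inj.
by rewrite -inner_self ortho eqxx.
Qed.

Lemma frame_fixed x : Phi (pt [set (x, x)]) (u x) = u x.
Proof. by rewrite PhiE ortho eqxx scale1r. Qed.

(** Since [u x] is fixed by the image of the diagonal matrix unit at x, multiplicativity reduces the
    value to a product of diagonal projections on X. *)
Lemma prj_frame B x : prj B (u x) = if `[< B x >] then u x else 0.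
Proof.
rewrite -{1}frame_fixed -mul_bopE -(PhiM PhiH); [|exact: dg_roe|exact: pt1_roe].
have -> : pt (dg B) * pt [set (x, x)] = (if `[< B x >] then pt [set (x, x)] else 0) :> bop R X.
  apply: bopP => w; apply: ell2P => z; rewrite mul_bopE crd_dg crd_pt1.
  have [->|zx] := eqVneq z x.
    by case: asboolP => _; rewrite ?crd_pt1 ?eqxx// zero_bopE crd_0.
  by case: asboolP => _; case: asboolP => _; rewrite ?crd_pt1 ?zero_bopE ?crd_0// (negPf zx).
by case: asboolP => _; rewrite ?frame_fixed// (Phi0 PhiH) zero_bopE.
Qed.

Lemma frame_row_sum y (F : {fset X}) : \sum_(x <- F) normc (crd (u x) y) ^+ 2 <= 1.
Proof.
have := bessel ortho (delta y) F; rewrite l2norm_delta expr1n.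
by under eq_bigr do rewrite inner_deltal -/(crd _ _) -/(cj _) normc_cj.
Qed.

(* The rank one operator [v (x) v] with [v := prj B (delta y)] lies below [prj B], hence in
   the range of [Phi], and its preimage is [beta (x) beta] with [beta x = <v, u x>]; comparing
   squares gives [|v| = |beta|]. *)
Lemma norm_prj_delta_le B y c :
  (forall F : {fset X}, (forall x, x \in F -> B x) ->
    \sum_(x <- F) normc (crd (u x) y) ^+ 2 <= c) ->
  l2norm (prj B (delta y)) ^+ 2 <= c.
Proof.
move=> hc; have c0 : 0 <= c by have := hc fset0; rewrite big_seq_fset0; apply.
have [b rb Pb] := rank_one_in_range PhiH Phi_her B y.
have [pp pa] := prj_projection PhiH B.
rewrite -/(prj B) in Pb pp pa *; set v := prj B (delta y) in Pb *.
have [->|v0] := eqVneq v 0; first by rewrite l2norm0 expr0n.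
have vu x : inner v (u x) = if `[< B x >] then cj (crd (u x) y) else 0.
  rewrite /v pa prj_frame; case: asboolP => _; last exact: inner0r. exact: inner_deltal.
have [beta hbeta nbeta] : exists2 beta : ell2 R X, (forall x, crd beta x =
  inner v (u x)) & l2norm beta ^+ 2 <= c.
  apply: ell2_of_bounded_sums => F; rewrite (eq_bigr (fun x =>
    if `[< B x >] then normc (crd (u x) y) ^+ 2 else 0)).
    rewrite -big_mkcond/= -big_filter.
    have -> : \sum_(i <- [seq i <- F | `[< B i >]]) normc (crd (u i) y) ^+ 2 =
      \sum_(i <- [fset i in F | `[< B i >]]%fset) normc (crd (u i) y) ^+ 2.
      by rewrite big_filter [RHS]big_fset/=.
    by apply: hc => x; rewrite !inE => /andP[_ /asboolP].
  by move=> x _; rewrite vu; case: asboolP => _; rewrite ?normc_cj// normc0 expr0n.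
(* Compression by matrix units shows that [b] has entries beta_x times the conjugate of beta_x'. *)
have bd x' : b (delta x') = cj (crd beta x') *: beta.
  apply: ell2P => x; rewrite crdZ.
  have rbb : uniform_roe X (pt [set (x, x)] * b) by apply: roeM => //; exact: pt1_roe.
  have E := congr1 (fun a => Phi a (u x')) (pt1_corner x x x' x' b).
  rewrite (PhiM PhiH)// in E; last exact: pt1_roe.
  rewrite (PhiM PhiH)// in E; last exact: pt1_roe.
  rewrite (PhiZ PhiH) in E; last exact: pt1_roe.
  rewrite !mul_bopE frame_fixed Pb bopZ scale_bopE !PhiE ortho eqxx scale1r in E.
  move/eqP: E; rewrite scalerA -subr_eq0 -scalerBl scaler_eq0 => /orP[|/eqP u0].
    by rewrite subr_eq0 => /eqP <-; rewrite !hbeta (innerC v (u x')).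
  by have := norm_frame x; rewrite u0 l2norm0 => /eqP; rewrite eq_sym oner_eq0.
(* The square of the rank one operator of v is |v|^2 times itself; injectivity carries this over to
   [b]. *)
have bb : b * b = rc (l2norm v ^+ 2) *: b.
  apply: (Phi_injE Phi_inj); first exact: roeM.
    exact: roeZ.
  rewrite (PhiM PhiH)// (PhiZ PhiH)//; apply: bopP => w.
  by rewrite mul_bopE scale_bopE !Pb innerZl inner_self !scalerA mulrC.
have [x1 bx1] : exists x, crd beta x != 0.
  apply: contrapT => no; have b0 : b = 0.
    apply: bop_ext => x; rewrite bd zero_bopE; have [->|h] := eqVneq (crd beta x) 0.
      by rewrite cj0 scale0r.
    by case: no; exists x.
  have := Pb v; rewrite b0 (Phi0 PhiH) zero_bopE inner_self => /esym/eqP.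
  rewrite scaler_eq0 (negPf v0) orbF -rc0 => /eqP/rc_inj/eqP.
  by rewrite sqrf_eq0 => /eqP/l2norm_eq0/eqP; rewrite (negPf v0).
have beta0 : beta != 0 by apply: contra_neq bx1 => ->; rewrite crd_0.
have bbeta : b beta = rc (l2norm v ^+ 2) *: beta.
  have := congr1 (fun a : bop R X => a (delta x1)) bb.
  rewrite mul_bopE scale_bopE bd bopZ scalerA mulrC -scalerA => /eqP.
  rewrite -subr_eq0 -scalerBr scaler_eq0 subr_eq0 => /orP[/eqP E|/eqP//].
  by move: bx1; rewrite -normc_gt0 -normc_cj E normc0 ltxx.
rewrite leNgt; apply/negP => cv.
have nb : 0 < l2norm beta by rewrite l2norm_gt0.
suff : l2norm v ^+ 2 * l2norm beta <= c * l2norm beta by rewrite ler_pM2r// leNgt cv.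
have -> : l2norm v ^+ 2 * l2norm beta = l2norm (b beta).
  by rewrite bbeta l2normZ normc_rc ger0_norm ?sqr_ge0.
(* On a truncation of [beta] the columns [bd] add up to a multiple of [beta] by a scalar at most c;
   the remainder is absorbed in e. *)
apply: le_eps => e e0; have ob : 0 < opnorm b + 1 by rewrite ltr_wpDl ?opnorm_ge0.
have [F hF] := trunc_cvg beta (divr_gt0 e0 ob); have {}hF := hF F (fsubset_refl F).
have -> : b beta = b (trunc F beta) + b (beta - trunc F beta) by rewrite -bopD addrC subrK.
apply: (le_trans (l2normD _ _)); apply: lerD; last first.
  apply: (le_trans (l2norm_le_opnorm _ _)).
  apply: (@le_trans _ _ ((opnorm b + 1) * (e / (opnorm b + 1)))).
    by apply: ler_pM; rewrite ?opnorm_ge0 ?l2norm_ge0// lerDl.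
  by rewrite mulrC divfK ?gt_eqF.
rewrite /trunc bop_sum.
under eq_bigr do rewrite bopZ bd scalerA -rc_sqr_normc.
rewrite -scaler_suml -rc_sum l2normZ normc_rc ger0_norm ?sumr_ge0// => [|i _]; last exact: sqr_ge0.
by rewrite ler_wpM2r ?l2norm_ge0// (le_trans (sq_sum_le_norm _ _)).
Qed.

End with_frame.

(** * Control of the supports of the frame *)

Section small.
Context {R : realType} {Z : choiceType}.

Lemma ell2_small (v : ell2 R Z) (t : R) : 0 < t ->
  exists F : {fset Z}, forall z, z \notin F -> normc (crd v z) <= t.
Proof.
move=> t0; have [F hF] := trunc_cvg v t0; exists F => z zF.
apply: le_trans (hF F (fsubset_refl F)); apply: le_trans (crd_le_norm _ z).
by rewrite crdD crdN crd_trunc (negPf zF) subr0.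
Qed.

Lemma pt_contraction (G : set (Z * Z)) (v : ell2 R Z) : l2norm (pt G v) <= l2norm v.
Proof.
have [p|n] := pselect (partial_inj G); last first.
  by rewrite /pt; case: pselect => // _; rewrite zero_bopE l2norm0 l2norm_ge0.
have E : inner (pt G v) (pt G v) = inner v (pt (dg [set y | exists x, G (x, y)]) v).
  by rewrite (pt_adjoint p) -mul_bopE ptTpt.
have [qq qa] := @pt_dg_projection R Z [set y | exists x, G (x, y)].
have E2 : l2norm (pt G v) ^+ 2 = l2norm (pt (dg [set y | exists x, G (x, y)]) v) ^+ 2.
  by apply: rc_inj; rewrite -!inner_self E -{1}qq mul_bopE qa.
have := projection_norm_le v (conj qq qa).
by rewrite -(@ler_pXn2r _ 2 _ _ (l2norm v)) ?nnegrE ?l2norm_ge0// -E2 ler_pXn2r ?nnegrE ?l2norm_ge0.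
Qed.

End small.

Section control.
Context {R : realType} {X Y : metricType R}.
Hypotheses (ulfX : uniformly_locally_finite X) (ulfY : uniformly_locally_finite Y).
Variable Phi : bop R X -> bop R Y.
Hypothesis PhiH : star_homomorphism (uniform_roe X) (uniform_roe Y) Phi.
Hypothesis Phi_inj : set_inj (uniform_roe X) Phi.
Hypothesis Phi_her : hereditary (uniform_roe Y) (Phi @` uniform_roe X).
Variable u : X -> ell2 R Y.
Hypothesis PhiE : forall x x' v, Phi (pt [set (x, x')]) v = inner v (u x') *: u x.
Hypothesis ortho : forall x x', inner (u x) (u x') = (x == x')%:R.
Implicit Types (a b : bop R X) (v w : ell2 R Y) (x : X) (y : Y) (B : set X).

(** [Phi (pt G)] is a partial isometry with this initial projection, because [pt (transp G) * pt G]
    is diagonal. *)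
Lemma norm_Phi_pt r (G : set (X * X)) w : ptrans r G ->
  l2norm (Phi (pt G) w) = l2norm (prj Phi [set x' | exists x, G (x, x')] w).
Proof.
move=> [p b]; set B := [set x' | _].
have bT : within r (transp G) by move=> x x' /b; rewrite metric_sym.
have [pp pa] := prj_projection PhiH B.
apply/eqP; rewrite -(@eqrXn2 _ 2) ?l2norm_ge0//; apply/eqP/rc_inj.
rewrite -!inner_self pa -mul_bopE pp.
rewrite (Phi_adjoint PhiH (pt_roe b) (pt_roe bT) (pt_adjoint p)).
by rewrite -mul_bopE -(PhiM PhiH (pt_roe bT) (pt_roe b)) ptTpt.
Qed.

(** When G avoids F, its initial projection lives on points outside F, where the sum of |u_x(y)|^2
    has a small tail. *)
Lemma Phi_pt_cont r y e : 0 < e -> exists F : {fset X}, forall G, ptrans r G ->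
  avoids F G -> l2norm (Phi (pt G) (delta y)) <= e.
Proof.
move=> e0; have e20 : 0 < e ^+ 2 by rewrite exprn_gt0.
have [F hF] := tail_small (fun x => sqr_ge0 (normc (crd (u x) y))) (frame_row_sum ortho y) e20.
exists F => G gG aG; rewrite (norm_Phi_pt _ gG).
rewrite -(@ler_pXn2r _ 2) ?nnegrE ?l2norm_ge0 ?(ltW e0)//.
apply: (norm_prj_delta_le PhiH Phi_inj Phi_her PhiE ortho) => E EB.
by apply: hF => x /EB[x' /aG[]].
Qed.

Lemma Phi_pt_add r (G H : set (X * X)) : ptrans r (G `|` H) -> (forall p, G p -> H p -> False) ->
  Phi (pt (G `|` H)) = Phi (pt G) + Phi (pt H).
Proof.
move=> g dis; rewrite ptU//; last exact: g.1.
by rewrite (PhiD PhiH)//; apply: (@pt_roe _ _ r) => x y h; apply: g.2; [left|right].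
Qed.

Lemma Phi_quasilocal r e : 0 < e -> exists s, forall G, ptrans r G ->
  (exists F : {fset X}, inside F G) -> forall v w, fsupp v -> sep s v w ->
  normc (inner (Phi (pt G) v) w) <= e * (l2norm v * l2norm w).
Proof.
apply: (gliding_hump (T := fun G => Phi (pt G)) ulfX).
- by move=> G [_ b]; apply: (Phi_roe PhiH); exact: pt_roe b.
- by move=> G H; exact: Phi_pt_add.
- by move=> y d d0; exact: Phi_pt_cont.
Qed.

Lemma fsupp_delta (Z : metricType R) (y : Z) : fsupp (delta y : ell2 R Z).
Proof.
exists [fset y]%fset => z; rewrite inE => zy; rewrite crd_delta.
by rewrite (negPf zy).
Qed.

Lemma sep_delta s (Z : metricType R) (y y' : Z) : s < mdist y y' ->
  sep s (delta y : ell2 R Z) (delta y').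
Proof.
move=> yy z z'; rewrite !crd_delta.
have [->|_] := eqVneq z y; last by rewrite eqxx.
by have [->|_] := eqVneq z' y'; last by rewrite eqxx.
Qed.

Lemma ptrans1 (Z : metricType R) r (z z' : Z) : mdist z z' <= r -> ptrans r [set (z, z')].
Proof. by move=> zz; split=> [|a b [-> ->]//]; exact: pinj1. Qed.

Lemma inside1 (Z : metricType R) (z z' : Z) : exists F : {fset Z}, inside F [set (z, z')].
Proof. by exists [fset z; z']%fset => a b [-> ->]; rewrite !inE !eqxx orbT. Qed.

(** The pair (x, x') yields a rank one operator whose entry at (y, y') has modulus |u_x(y)|
    |u_x'(y')| >= del^2, too large for the tolerance del^2/2 once y and y' are separated. *)
Lemma upper_control (del r : R) : 0 < del -> exists s, forall x x' y y',
  del <= normc (crd (u x) y) -> del <= normc (crd (u x') y') ->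
  mdist x x' <= r -> mdist y y' <= s.
Proof.
move=> d0; have e0 : 0 < del ^+ 2 / 2 by rewrite divr_gt0// exprn_gt0.
have [s hs] := Phi_quasilocal r e0; exists s => x x' y y' xy xy' xx.
rewrite leNgt; apply/negP => yy.
have := hs _ (ptrans1 xx) (inside1 x x') (delta y') (delta y) (fsupp_delta _).
rewrite !l2norm_delta !mulr1 PhiE innerZl inner_deltal inner_deltar -/(cj _) normcM normc_cj.
rewrite metric_sym in yy => /(_ (sep_delta yy)).
have := ler_pM (ltW d0) (ltW d0) xy' xy; rewrite -expr2.
have := exprn_gt0 2 d0; move: (normc _ * normc _) (del ^+ 2) => *; lra.
Qed.

Definition unit_prj := Phi 1.

Lemma unit_prj_projection : projection unit_prj.
Proof. by have := prj_projection PhiH setT; rewrite /prj pt_dgT. Qed.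

Lemma unit_prj_roe : uniform_roe Y unit_prj.
Proof. exact/(Phi_roe PhiH)/roe1. Qed.

Lemma unit_prj_frame x : unit_prj (u x) = u x.
Proof.
by have := prj_frame PhiH PhiE ortho setT x; rewrite /prj pt_dgT asboolT.
Qed.

(** With M the norm of h, the compression of h + M lies between 0 and 2M [unit_prj], an element of
    the range; heredity gives a preimage, from which M is subtracted. *)
Lemma sa_corner_in_range (h : bop R Y) : uniform_roe Y h -> is_adjoint h h ->
  exists2 a, uniform_roe X a & Phi a = unit_prj * h * unit_prj.
Proof.
move=> rh hh; pose M := opnorm h; have [qq qa] := unit_prj_projection.
have real w : inner (h w) w = rc (complex.Re (inner (h w) w)).
  by apply: cj_real; rewrite -innerC; exact/esym/hh.
have bd w : `|complex.Re (inner (h w) w)| <= M * l2norm w ^+ 2.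
  apply: (le_trans (normr_Re_le_normc _)); apply: (le_trans (cauchy_schwarz _ _)).
  by rewrite expr2 mulrA ler_wpM2r ?l2norm_ge0// l2norm_le_opnorm.
have r1 : uniform_roe X (rc M *: (1 : bop R X)) by apply: roeZ; exact: roe1.
have r2 : uniform_roe X (rc (2 * M) *: (1 : bop R X)) by apply: roeZ; exact: roe1.
pose t : bop R Y := unit_prj * (h + rc M *: (1 : bop R Y)) * unit_prj.
have tin v : inner (t v) v = inner (h (unit_prj v)) (unit_prj v) +
  rc (M * l2norm (unit_prj v) ^+ 2).
  rewrite /t !mul_bopE qa add_bopE scale_bopE one_bopE innerDl innerZl inner_self.
  by rewrite -rcM.
have [a ra Pa] : (Phi @` uniform_roe X) t.
  apply: (@Phi_her t (Phi (rc (2 * M) *: (1 : bop R X)))).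
  - apply: roeM; last exact: unit_prj_roe.
    apply: roeM; first exact: unit_prj_roe.
    by apply: roeD => //; apply: roeZ; exact: roe1.
  - by exists (rc (2 * M) *: (1 : bop R X)).
  - move=> v; rewrite tin real -rcD -[0]rc0 rc_le.
    by have := bd (unit_prj v); rewrite ler_norml => /andP[]; lra.
  - move=> v; rewrite add_bopE opp_bopE innerBl tin (PhiZ PhiH)//; last exact: roe1.
    rewrite scale_bopE innerZl -/unit_prj -{1}qq mul_bopE qa inner_self real -rcM -rcD -rcB.
    rewrite -[0]rc0 rc_le.
    by have := bd (unit_prj v); rewrite ler_norml => /andP[]; lra.
exists (a - rc M *: (1 : bop R X)); first exact: roeB.
rewrite (PhiD PhiH)//; last exact: roeN.
rewrite -scaleNr (PhiZ PhiH)//; last exact: roe1.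
rewrite Pa scaleNr -/unit_prj /t mulrDr mulrDl.
apply: bopP => v; rewrite add_bopE opp_bopE !add_bopE !mul_bopE !scale_bopE one_bopE.
by rewrite bopZ -[unit_prj (unit_prj v)]mul_bopE qq addrK.
Qed.

Lemma is_adjointD (Z : choiceType) (a b c d : bop R Z) : is_adjoint a c -> is_adjoint b d ->
  is_adjoint (a + b) (c + d).
Proof. by move=> h1 h2 v w; rewrite !add_bopE innerDl innerDr h1 h2. Qed.

Lemma is_adjointZ (Z : choiceType) k (a c : bop R Z) : is_adjoint a c ->
  is_adjoint (k *: a) (cj k *: c).
Proof. by move=> h1 v w; rewrite !scale_bopE innerZl innerZr h1 cjK. Qed.

(** Twice b is (b + b') - i (i (b - b')), where both b + b' and i (b - b') are self-adjoint. *)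
Lemma corner_in_range (b b' : bop R Y) : uniform_roe Y b -> uniform_roe Y b' -> is_adjoint b b' ->
  exists2 a, uniform_roe X a & Phi a = unit_prj * b * unit_prj.
Proof.
move=> rb rb' bb; pose i : R[i] := 0 +i* 1.
have ci : cj i = - i by rewrite /i /cj /=; congr (_ +i* _); rewrite oppr0.
have ii : i * i = -1 by rewrite /i; apply/eqP;
  rewrite eq_complex/= !(mul0r, mulr0, mul1r, sub0r, addr0) oppr0 !eqxx.
have [a1 r1 P1] : exists2 a, uniform_roe X a & Phi a = unit_prj * (b + b') * unit_prj.
  apply: sa_corner_in_range; first exact: roeD.
  by rewrite {2}addrC; apply: is_adjointD => //; exact: is_adjoint_sym.
have [a2 r2 P2] : exists2 a, uniform_roe X a & Phi a = unit_prj * (i *: (b - b')) * unit_prj.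
  apply: sa_corner_in_range; first by apply: roeZ; exact: roeB.
  have -> : i *: (b - b') = i *: b + (- i) *: b' by rewrite scalerBr scaleNr.
  rewrite {2}addrC; apply: is_adjointD.
    by rewrite -ci; exact: is_adjointZ.
  have {2}-> : i = cj (- i) by rewrite cjN ci opprK.
  by apply: is_adjointZ; exact: is_adjoint_sym.
exists (2^-1 *: (a1 + (- i) *: a2)).
  by apply: roeZ; apply: roeD => //; exact: roeZ.
rewrite (PhiZ PhiH); last by apply: roeD => //; exact: roeZ.
rewrite (PhiD PhiH)//; last exact: roeZ.
rewrite (PhiZ PhiH)// P1 P2; apply: bopP => v.
rewrite scale_bopE add_bopE scale_bopE !mul_bopE -bopZ -bopD -bopZ; congr (unit_prj _).
rewrite !(add_bopE, scale_bopE, opp_bopE) scalerA mulNr ii opprK scale1r.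
rewrite addrACA subrr addr0 -[b _]scale1r -scalerDl scalerA.
rewrite (_ : 2^-1 * (1 + 1) = 1) ?scale1r//.
by apply: mulVf; rewrite pnatr_eq0.
Qed.

Lemma corner_coord (a : bop R X) (b : bop R Y) x x' : uniform_roe X a ->
  Phi a = unit_prj * b * unit_prj -> crd (a (delta x')) x = inner (b (u x')) (u x).
Proof.
move=> ra Pa; have [_ qa] := unit_prj_projection.
have rbb : uniform_roe X (pt [set (x, x)] * a) by apply: roeM => //; exact: pt1_roe.
have E := congr1 (fun c => Phi c (u x')) (pt1_corner x x x' x' a).
rewrite (PhiM PhiH)// in E; last exact: pt1_roe.
rewrite (PhiM PhiH)// in E; last exact: pt1_roe.
rewrite (PhiZ PhiH) in E; last exact: pt1_roe.
rewrite Pa !mul_bopE (frame_fixed PhiE ortho) unit_prj_frame scale_bopE !PhiE ortho eqxx scale1r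
  qa unit_prj_frame in E.
move/eqP: E; rewrite -subr_eq0 -scalerBl scaler_eq0 => /orP[|/eqP u0].
  by rewrite subr_eq0 => /eqP <-.
by have := norm_frame ortho x; rewrite u0 l2norm0 => /eqP; rewrite eq_sym oner_eq0.
Qed.

(** The gliding hump with X and Y exchanged. For a single pair (y, y') the preimage [T G] has at (x,
    x') the entry u_x'(y') times the conjugate of u_x(y), of modulus at least del^2. *)
Lemma lower_control (del r : R) : 0 < del -> exists s, forall x x' y y',
  del <= normc (crd (u x) y) -> del <= normc (crd (u x') y') ->
  mdist y y' <= r -> mdist x x' <= s.
Proof.
move=> d0; have e0 : 0 < del ^+ 2 / 2 by rewrite divr_gt0// exprn_gt0.
have exT (G : set (Y * Y)) : exists a : bop R X, ptrans r G ->
    uniform_roe X a /\ Phi a = unit_prj * pt G * unit_prj.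
  have [[p b]|n] := pselect (ptrans r G); last by exists 0.
  have bT : within r (transp G) by move=> x x' /b; rewrite metric_sym.
  have [a ra Pa] := corner_in_range (pt_roe b) (pt_roe bT) (pt_adjoint p).
  by exists a.
have [T hT] := choice exT.
have [s hs] : exists s, forall G, ptrans r G -> (exists F : {fset Y}, inside F G) ->
    forall (v w : ell2 R X), fsupp v -> sep s v w ->
    normc (inner (T G v) w) <= del ^+ 2 / 2 * (l2norm v * l2norm w).
  apply: (gliding_hump (T := T) ulfY) => //.
  - by move=> G /hT[].
  - move=> G H gGH dis.
    have gG : ptrans r G by apply: ptrans_sub gGH; exact: subsetUl.
    have gH : ptrans r H by apply: ptrans_sub gGH; exact: subsetUr.
    have [r1 P1] := hT _ gGH; have [r2 P2] := hT _ gG; have [r3 P3] := hT _ gH.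
    apply: (Phi_injE Phi_inj) => //; first exact: roeD.
    by rewrite (PhiD PhiH)// P1 P2 P3 ptU//; [rewrite mulrDr mulrDl|exact: gGH.1].
  (* By Bessel, |T G delta_x| is at most |pt G u_x|, and a G avoiding F sees only the tail of
     [u x]. *)
  - move=> x d dp; have [F hF] := trunc_cvg (u x) dp; exists F => G gG aG.
    have [rT PT] := hT _ gG.
    apply: (@le_trans _ _ (l2norm (pt G (u x)))).
      rewrite -(@ler_pXn2r _ 2) ?nnegrE ?l2norm_ge0//.
      apply: sqr_norm_le => K; apply: le_trans (bessel ortho _ K).
      by apply: ler_sum => x' _; rewrite (corner_coord _ _ rT PT).
    apply: le_trans (hF F (fsubset_refl F)).
    have -> : pt G (u x) = pt G (u x - trunc F (u x)).
      apply: ell2P => y; have [[y' g]|n] := pselect (exists y', G (y, y')).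
        rewrite !(crd_pt _ gG.1 g) crdD crdN crd_trunc.
        by have [_ /negPf ->] := aG _ _ g; rewrite subr0.
      have n' y' : ~ G (y, y') by move=> g; apply: n; exists y'.
      by rewrite !(crd_pt0 _ gG.1 n').
    exact: pt_contraction.
exists s => x x' y y' xy xy' yy; rewrite leNgt; apply/negP => xx.
have := hs _ (ptrans1 yy) (inside1 y y') (delta x') (delta x) (fsupp_delta _).
have gG : ptrans r [set (y, y')] := ptrans1 yy; have [rT PT] := hT _ gG.
rewrite !l2norm_delta !mulr1 inner_deltar (corner_coord _ _ rT PT) pt1E innerZl.
rewrite inner_deltal -/(cj _) normcM normc_cj.
rewrite metric_sym in xx => /(_ (sep_delta xx)).
have := ler_pM (ltW d0) (ltW d0) xy' xy; rewrite -expr2.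
have := exprn_gt0 2 d0; move: (normc _ * normc _) (del ^+ 2) => *; lra.
Qed.

End control.

(** * Ghost projections and rigidity *)

Section sequences.
Context {R : realType}.

(** The sequence may repeat values, so each point of F is charged to just one of its indices. *)
Lemma sum_fset_le_seq (Z : choiceType) (f : Z -> R) (xs : nat -> Z) : (forall z, 0 <= f z) ->
  forall M (F : {fset Z}), (forall z, z \in F -> exists2 n, (n < M)%N & z = xs n) ->
  \sum_(z <- F) f z <= \sum_(n < M) f (xs n).
Proof.
move=> f0; elim=> [|M IH] F hF.
  rewrite big1_fset ?big_ord0// => z zF _.
  by have [] := hF _ zF.
rewrite big_ord_recr/=; have [xF|xF] := boolP (xs M \in F).
  rewrite (big_fsetD1 (xs M))//= addrC lerD2r; apply: IH => z; rewrite !inE => /andP[zx zF].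
  have [n nM E] := hF _ zF; exists n => //; rewrite ltn_neqAle -ltnS nM andbT.
  by apply: contra zx => /eqP nE; rewrite E nE.
apply: le_trans (IH F _) _; last by rewrite lerDl.
move=> z zF; have [n nM E] := hF _ zF; exists n => //; rewrite ltn_neqAle -ltnS nM andbT.
by apply: contra xF => /eqP nE; rewrite -nE -E.
Qed.

Lemma fset_bound (Z : choiceType) (xs : nat -> Z) (F : {fset Z}) :
  (forall z, z \in F -> exists n, z = xs n) ->
  exists M, forall z, z \in F -> exists2 n, (n < M)%N & z = xs n.
Proof.
elim/fset1U_rect: F => [_|z F zF IH h]; first by exists 0%N.
have [M hM] : exists M, forall z, z \in F -> exists2 n, (n < M)%N & z = xs n.
  by apply: IH => w wF; apply: h; rewrite !inE wF orbT.
have [n nE] := h z (fset1U1 _ _); exists (maxn M n.+1) => w;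
  rewrite !inE => /orP[/eqP ->|/hM[m mM ->]].
  by exists n => //; rewrite leq_max ltnSn orbT.
by exists m => //; rewrite leq_max mM.
Qed.

(** The last two terms are the exact geometric sum over the indices from N to N + k - 1; keeping the
    negative one closes the induction. *)
Lemma geometric_bound (a : nat -> R) N k : (forall n, a n <= 2^-1 ^+ n) ->
  \sum_(n < N + k) a n <= \sum_(n < N) a n + 2 * 2^-1 ^+ N - 2 * 2^-1 ^+ (N + k).
Proof.
move=> ha; elim: k => [|k IH]; first by rewrite addn0 addrK.
rewrite addnS big_ord_recr/= exprS; have := ha (N + k)%N; move: IH.
by move: (\sum_(_ < N + k) _) (\sum_(_ < N) _) (2^-1 ^+ N) (2^-1 ^+ (N + k)) (a _) => *; lra.
Qed.

Lemma geometric_small (e : R) : 0 < e -> exists N, 2 * 2^-1 ^+ N <= e :> R.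
Proof.
move=> e0; have : (fun n => 2^-1 ^+ n : R) @ \oo --> (0 : R).
  by apply: cvg_expr; rewrite ger0_norm// invf_lt1// ltr1n.
move=> /cvgrPdist_le/(_ (e / 2) (divr_gt0 e0 (ltr0Sn _ 1))) [N _ hN].
exists N; have := hN N (leqnn N); rewrite sub0r normrN ger0_norm ?exprn_ge0//.
by rewrite ler_pdivlMr// mulrC.
Qed.

End sequences.

Section rigidity.
Context {R : realType} {X Y : metricType R}.
Variable Phi : bop R X -> bop R Y.
Hypothesis PhiH : star_homomorphism (uniform_roe X) (uniform_roe Y) Phi.
Hypothesis Phi_inj : set_inj (uniform_roe X) Phi.
Hypothesis Phi_her : hereditary (uniform_roe Y) (Phi @` uniform_roe X).
Variable u : X -> ell2 R Y.
Hypothesis PhiE : forall x x' v, Phi (pt [set (x, x')]) v = inner v (u x') *: u x.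
Hypothesis ortho : forall x x', inner (u x) (u x') = (x == x')%:R.
Hypothesis ghosts : forall p : bop R Y,
  uniform_roe Y p -> ghost p -> projection p -> compact_op p.
Implicit Types (v w : ell2 R Y) (x : X) (y : Y) (B : set X).

Lemma sum_small_off (N : nat) (w : nat -> ell2 R Y) (e : R) : 0 < e ->
  exists F : {fset Y}, forall y, y \notin F -> \sum_(n < N) normc (crd (w n) y) ^+ 2 <= e.
Proof.
elim: N e => [|N IH] e e0; first by exists fset0 => y _; rewrite big_ord0 ltW.
have e2 : 0 < e / 2 by rewrite divr_gt0.
have [F hF] := IH _ e2.
have s0 : 0 < Num.sqrt (e / 2) by rewrite sqrtr_gt0.
have [G hG] := ell2_small (w N) s0; exists (F `|` G)%fset => y.
rewrite inE negb_or => /andP[yF yG]; rewrite big_ord_recr/= (splitr e); apply: lerD.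
  exact: hF.
rewrite -[leRHS]sqr_sqrtr ?(ltW e2)// ler_pXn2r ?nnegrE ?normc_ge0 ?(ltW s0)//.
exact: hG.
Qed.

(** A cluster point of the [w n] has all coordinates zero, by their decay, and yet lies within 1/2
    of a unit vector. *)
Lemma not_compact (p : bop R Y) (w : nat -> ell2 R Y) :
  (forall n, p (w n) = w n) -> (forall n, l2norm (w n) = 1) ->
  (forall n y, normc (crd (w n) y) ^+ 2 <= 2^-1 ^+ n) -> ~ compact_op p.
Proof.
move=> pw w1 wy cp.
have wF : (w @ \oo) (closure (p @` [set x | `|x| <= 1])).
  exists 0%N => // n _; apply: subset_closure; exists (w n) => //=.
  by rewrite -[leLHS]/(rc (l2norm (w n))) w1.
have [c [_ cl]] := cp _ _ wF.
have near (e : R) (N : nat) : 0 < e -> exists2 n, (N <= n)%N & l2norm (c - w n) <= e.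
  move=> e0; have e0' : (0 : R[i]) < rc e by rewrite -[0]rc0 ltcR.
  have [|_ [[n Nn <-]]] := cl [set w n | n in [set n | (N <=
    n)%N]] (ball c (rc e)) _ (nbhsx_ballx c (rc e) e0').
    by exists N => // n Nn; exists n.
  rewrite -ball_normE/= => h; exists n => //; rewrite -rc_le; exact: ltW.
have c0 : c = 0.
  apply: ell2P => y; rewrite crd_0; apply: eq0_normc; apply/eqP.
  rewrite eq_le normc_ge0 andbT; apply: le_eps => e e0; rewrite add0r.
  have e2 : 0 < e / 2 by rewrite divr_gt0.
  have [N hN] := geometric_small (exprn_gt0 2 e2).
  have [n Nn cn] := near _ N e2.
  have -> : crd c y = crd (c - w n) y + crd (w n) y by rewrite crdD crdN subrK.
  apply: (le_trans (le_normcD _ _)); rewrite (splitr e); apply: lerD.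
    exact: le_trans (crd_le_norm _ _) cn.
  rewrite -(@ler_pXn2r _ 2) ?nnegrE ?normc_ge0 ?(ltW e2)//.
  apply: (le_trans (wy n y)); apply: le_trans hN.
  apply: (@le_trans _ _ (2^-1 ^+ N)).
    by rewrite ler_iXn2l// ?invr_gt0// invf_lt1// ltr1n.
  by rewrite ler_peMl ?exprn_ge0// ler1n.
have [|n _] := near (2^-1) 0%N; first by rewrite invr_gt0.
by rewrite c0 sub0r l2normN w1 leNgt invf_lt1 ?ltr1n.
Qed.

(* A sequence of vectors [u (xs n)] whose sup norms decay geometrically would span the range of
   the ghost projection [Phi (chi_A)], [A := range xs]. *)
Lemma rigid : exists2 del : R, 0 < del & forall x, exists y, del <= normc (crd (u x) y).
Proof.
apply: contrapT => no.
have small (n : nat) : exists x, forall y, normc (crd (u x) y) ^+ 2 <= 2^-1 ^+ n.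
  apply: contrapT => no'; apply: no; exists (Num.sqrt (2^-1 ^+ n)).
    by rewrite sqrtr_gt0 exprn_gt0// invr_gt0.
  move=> x; apply: contrapT => nx; apply: no'; exists x => y.
  rewrite -[leRHS]sqr_sqrtr ?exprn_ge0 ?invr_ge0// ler_pXn2r ?nnegrE ?normc_ge0 ?sqrtr_ge0//.
  by rewrite leNgt; apply/negP => h; apply: nx; exists y; exact: ltW.
have [xs hxs] := choice small.
pose A := range xs; pose p := prj Phi A.
have pp : projection p := prj_projection PhiH A.
have pw n : p (u (xs n)) = u (xs n).
  by rewrite /p (prj_frame PhiH PhiE ortho) asboolT//; exists n.
apply: (@not_compact p (u \o xs)) => [n|n|n y|] //=.
  exact: norm_frame ortho _.
apply: ghosts => //; first exact: prj_roe PhiH _.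
move=> eps eps0; have e2 : 0 < eps / 2 by rewrite divr_gt0.
have e4 : 0 < eps / 2 / 2 by rewrite divr_gt0.
have [N hN] := geometric_small e4.
have [F hF] := sum_small_off N (u \o xs) e4.
(* Off F the first N vectors contribute at most eps/4, since they are finitely many elements of l2;
   the others contribute at most eps/4 by the geometric decay. *)
have bnd y : y \notin F -> l2norm (p (delta y)) ^+ 2 <= eps / 2.
  move=> yF; apply: (norm_prj_delta_le PhiH Phi_inj Phi_her PhiE ortho) => E EA.
  have [M hM] : exists M, forall z, z \in E -> exists2 n, (n < M)%N & z = xs n.
    by apply: fset_bound => z /EA[n _ <-]; exists n.
  apply: (@le_trans _ _ (\sum_(n < N + M) normc (crd (u (xs n)) y) ^+ 2)).
    apply: (sum_fset_le_seq (fun z => sqr_ge0 (normc (crd (u z) y)))) => z /hM[n nM ->].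
    by exists n => //; rewrite ltn_addl.
  have := @geometric_bound R (fun n => normc (crd (u (xs n)) y) ^+ 2) N M (fun n => hxs n y).
  have := hF y yF; rewrite /=.
  have : 0 <= 2^-1 ^+ (N + M) :> R by rewrite exprn_ge0.
  by move: hN; move: (\sum_(_ < N + M) _) (\sum_(_ < N) _) (2^-1 ^+ N) (2^-1 ^+ (N + M)) => *; lra.
exists [set` F]; first exact: finite_fset.
move=> z w zF wF.
have {}zF : z \notin F by apply/negP.
have {}wF : w \notin F by apply/negP.
apply: (@le_lt_trans _ _ (eps / 2)); last by rewrite ltr_pdivrMr// ltr_pMr// ltr1n.
apply: (le_trans (projection_inner_le _ _ pp)).
rewrite -(@ler_pXn2r _ 2) ?nnegrE ?mulr_ge0 ?l2norm_ge0 ?(ltW eps0)// exprMn [leRHS]expr2.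
by apply: ler_pM; rewrite ?sqr_ge0// bnd.
Qed.

End rigidity.

(** * Hall's condition *)

Lemma linear_dependence (K : fieldType) (X Y : choiceType) (A : {fset X}) (N : {fset Y})
    (M : X -> Y -> K) : (#|` N| < #|` A|)%N ->
  exists2 xi : X -> K, (exists2 x, x \in A & xi x != 0) &
    forall y, y \in N -> \sum_(x <- A) xi x * M x y = 0.
Proof.
rewrite !cardfE => NA.
pose mx : 'M[K]_(#|{: A}|, #|{: N}|) := \matrix_(i, j) M (val (enum_val i)) (val (enum_val j)).
have ker0 : kermx mx != 0.
  rewrite -mxrank_eq0 mxrank_ker subn_eq0 -ltnNge.
  by apply: leq_ltn_trans NA; exact: rank_leq_col.
have /sub_kermxP vM := nz_row_sub (kermx mx).
have : nz_row (kermx mx) != 0 by rewrite nz_row_eq0.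
move: (nz_row (kermx mx)) vM => v vM v0.
pose xi x := if insub x : option A is Some a then v 0 (enum_rank a) else 0.
have xiE (a : A) : xi (val a) = v 0 (enum_rank a) by rewrite /xi valK.
exists xi.
  have [i vi] : exists i, v 0 i != 0.
    by apply/rV0Pn.
  by exists (val (enum_val i)); [exact: valP|rewrite xiE enum_valK].
move=> y yN; rewrite big_seq_fsetE/=.
have := congr1 (fun m : 'rV_#|{: N}| => m 0 (enum_rank [` yN]%fset)) vM.
rewrite !mxE => E; rewrite -[RHS]E (reindex (@enum_val _ {: A}))/=; last first.
  by exists enum_rank => a _; rewrite ?enum_valK ?enum_rankK.
by apply: eq_bigr => i _; rewrite mxE xiE enum_valK enum_rankK.
Qed.

Section signs.
Context {R : realType} {X : eqType}.

(** Averaging over independent signs leaves only the diagonal. Here the signs are chosen one at a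
    time, each making the new cross terms add up to a nonnegative number. *)
Lemma good_signs (c : X -> X -> R) (l : seq X) : uniq l ->
  exists t : X -> bool, \sum_(x <- l) c x x <=
    \sum_(x <- l) \sum_(x' <- l) (-1) ^+ t x * (-1) ^+ t x' * c x x'.
Proof.
elim: l => [|z l IH]; first by exists xpredT; rewrite !big_nil.
move=> /= /andP[zl /IH[t ht]].
pose d := \sum_(x <- l) (-1) ^+ t x * (c z x + c x z).
pose t' x := if x == z then d < 0 else t x.
have tz : t' z = (d < 0) by rewrite /t' eqxx.
have tl x : x \in l -> t' x = t x.
  by move=> xl; rewrite /t'; case: eqP => // xz; move: zl; rewrite -xz xl.
exists t'; rewrite !big_cons.
have -> : \sum_(j <- l) \sum_(x' <- z :: l) (-1) ^+ t' j * (-1) ^+ t' x' * c j x' =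
   \sum_(j <- l) (-1) ^+ t' j * (-1) ^+ t' z * c j z +
   \sum_(x <- l) \sum_(x' <- l) (-1) ^+ t x * (-1) ^+ t x' * c x x'.
  rewrite -big_split/= big_seq [RHS]big_seq; apply: eq_bigr => x xl.
  rewrite big_cons; congr (_ + _); rewrite big_seq [RHS]big_seq.
  by apply: eq_bigr => x' xl'; rewrite !tl.
have -> : \sum_(j <- l) (-1) ^+ t' z * (-1) ^+ t' j * c z j =
   (-1) ^+ t' z * \sum_(j <- l) (-1) ^+ t j * c z j.
  by rewrite mulr_sumr big_seq [RHS]big_seq; apply: eq_bigr => x xl; rewrite (tl x xl); ring.
have -> : \sum_(j <- l) (-1) ^+ t' j * (-1) ^+ t' z * c j z =
   (-1) ^+ t' z * \sum_(j <- l) (-1) ^+ t j * c j z.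
  by rewrite mulr_sumr big_seq [RHS]big_seq; apply: eq_bigr => x xl; rewrite (tl x xl); ring.
have dE : d = \sum_(j <- l) (-1) ^+ t j * c z j + \sum_(j <- l) (-1) ^+ t j * c j z.
  by rewrite -big_split/=; apply: eq_bigr => x _; rewrite mulrDr.
have dp : 0 <= (-1) ^+ t' z * d.
  by rewrite tz; case: ltP => d0; rewrite ?expr1 ?expr0 ?mul1r// mulN1r oppr_ge0 ltW.
have sq : (-1) ^+ t' z * (-1) ^+ t' z = 1 :> R by rewrite -expr2 sqrr_sign.
move: dp; rewrite dE sq mul1r mulrDr; move: ht.
by move: (\sum_(_ <- l) _) (\sum_(_ <- l) \sum_(_ <- l) _) (_ * _) (_ * _) (c z z) => *; lra.
Qed.

End signs.

Section counting.
Context {R : realType} {X Y : metricType R}.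
Hypothesis ulfX : uniformly_locally_finite X.
Variable Phi : bop R X -> bop R Y.
Hypothesis PhiH : star_homomorphism (uniform_roe X) (uniform_roe Y) Phi.
Hypothesis Phi_inj : set_inj (uniform_roe X) Phi.
Hypothesis Phi_her : hereditary (uniform_roe Y) (Phi @` uniform_roe X).
Variable u : X -> ell2 R Y.
Hypothesis PhiE : forall x x' v, Phi (pt [set (x, x')]) v = inner v (u x') *: u x.
Hypothesis ortho : forall x x', inner (u x) (u x') = (x == x')%:R.
Variables (f : X -> Y) (del : R).
Hypothesis del0 : 0 < del.
Hypothesis fdel : forall x, del <= normc (crd (u x) (f x)).
Implicit Types (v w : ell2 R Y) (x : X) (y : Y) (A : {fset X}).

(** Each point of the fibre contributes at least del^2 to the sum of |u_x(y)|^2, which Bessel bounds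
    by 1. *)
Lemma fiber_bound A y : (forall x, x \in A -> f x = y) -> del ^+ 2 * #|` A|%:R <= 1.
Proof.
move=> Ay; apply: le_trans (frame_row_sum ortho y A).
rewrite cardfE -sum1_card natr_sum mulr_sumr big_seq_fsetE/=.
apply: ler_sum => x _; rewrite mulr1 ler_pXn2r ?nnegrE ?normc_ge0 ?(ltW del0)//.
by rewrite -(Ay _ (valP x)).
Qed.

(** Schur test for the 0-1 matrix of the relation f x = f x': by |k k'| <= (|k|^2 + |k'|^2) / 2 and
    symmetry, the fibre size bounds the form, and it is at most del^-2. *)
Lemma norm_pushforward A (k : X -> R[i]) :
  del ^+ 2 * l2norm (\sum_(x <- A) k x *: delta (f x)) ^+ 2 <= \sum_(x <- A) normc (k x) ^+ 2.
Proof.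
pose b x x' : R := (f x == f x')%:R.
have vv : l2norm (\sum_(x <- A) k x *: delta (f x)) ^+ 2 <=
    \sum_(x <- A) \sum_(x' <- A) b x x' * (normc (k x) * normc (k x')).
  rewrite -[leLHS]ger0_norm ?sqr_ge0// -normc_rc -inner_self inner_suml.
  apply: (le_trans (normc_sum _ _ _)); apply: ler_sum => x _.
  rewrite inner_sumr; apply: (le_trans (normc_sum _ _ _)); apply: ler_sum => x' _.
  rewrite innerZl innerZr inner_deltar crd_delta !normcM normc_cj /b.
  have -> : normc ((f x' == f x)%:R : R[i]) = (f x == f x')%:R.
    by rewrite eq_sym; case: (_ == _); rewrite ?normc1 ?normc0.
  by rewrite eq_sym le_eqVlt; apply/orP; left; apply/eqP; ring.
have ww : \sum_(x <- A) \sum_(x' <- A) b x x' * (normc (k x) * normc (k x')) <=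
    \sum_(x <- A) \sum_(x' <- A) b x x' * normc (k x) ^+ 2.
  have -> : \sum_(x <- A) \sum_(x' <- A) b x x' * normc (k x) ^+ 2 =
     \sum_(x <- A) \sum_(x' <- A) b x x' * ((normc (k x) ^+ 2 + normc (k x') ^+ 2) / 2).
    have E : \sum_(x <- A) \sum_(x' <- A) b x x' * normc (k x') ^+ 2 =
       \sum_(x <- A) \sum_(x' <- A) b x x' * normc (k x) ^+ 2.
      rewrite exchange_big/=; apply: eq_bigr => x _; apply: eq_bigr => x' _.
      by rewrite /b eq_sym.
    have E2 : \sum_(x <- A) \sum_(x' <- A) b x x' * ((normc (k x) ^+ 2 + normc (k x') ^+ 2) / 2) =
       2^-1 * (\sum_(x <- A) \sum_(x' <- A) b x x' * normc (k x) ^+ 2 +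
               \sum_(x <- A) \sum_(x' <- A) b x x' * normc (k x') ^+ 2).
      rewrite -big_split mulr_sumr; apply: eq_bigr => x _.
      by rewrite -big_split mulr_sumr; apply: eq_bigr => x' _ /=; ring.
    by rewrite E2 E; move: (\sum_(_ <- _) _) => *; lra.
  apply: ler_sum => x _; apply: ler_sum => x' _.
  apply: ler_wpM2l; first by rewrite /b.
  have := sqr_ge0 (normc (k x) - normc (k x')); rewrite sqrrB.
  by move: (normc (k x)) (normc (k x')) => p q; rewrite -mulr_natl; lra.
apply: (le_trans (ler_wpM2l (sqr_ge0 del) (le_trans vv ww))).
rewrite mulr_sumr; apply: ler_sum => x _.
rewrite -mulr_suml mulrA ler_piMl ?sqr_ge0//.
have := @fiber_bound [fset x' in A | f x == f x']%fset (f x).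
have -> : \sum_(x' <- A) b x x' = #|` [fset x' in A | f x == f x']%fset|%:R.
  by rewrite card_fset_sum1 natr_sum big_fset/= [RHS]big_mkcond/=; apply: eq_bigr => x' _;
    rewrite /b; case: eqP.
by apply => x'; rewrite !inE => /andP[_ /eqP].
Qed.

(** Diagonal projections are partial translations of displacement 0, so one scale serves all finite
    A. *)
Lemma prj_quasilocal e : 0 < e -> exists s, forall A v w, fsupp v -> sep s v w ->
  normc (inner (prj Phi [set` A] v) w) <= e * (l2norm v * l2norm w).
Proof.
move=> e0; have [s hs] := Phi_quasilocal ulfX PhiH Phi_inj Phi_her PhiE ortho 0 e0.
exists s => A v w fv vw; apply: hs => //; last first.
  by exists A => x x' [/= <- xA].
by split; [exact: pinj_dg|move=> x x' [/= <- _]; rewrite mdistxx].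
Qed.

Lemma prj_ortho_sum B A (k : X -> R[i]) : prj Phi B (\sum_(x <- A) k x *: u x) =
  \sum_(x <- A) (if `[< B x >] then k x else 0) *: u x.
Proof.
rewrite bop_sum; apply: eq_bigr => x _; rewrite bopZ (prj_frame PhiH PhiE ortho).
by case: asboolP => _; rewrite ?scaler0 ?scale0r.
Qed.

(* If the neighbourhood were too small, some nonzero [w] in the span of [u x], [x \in A], would
   vanish on it.  With suitable signs [t], the vector [v] supported on [f A] satisfies
   [Re <(p_+ - p_-) v, w> >= |w|^2], against quasi-locality of the projections. *)
Lemma hall_count : exists s, forall A (N : {fset Y}),
  (forall x y, x \in A -> mdist (f x) y <= s -> y \in N) -> (#|` A| <= #|` N|)%N.
Proof.
have e0 : 0 < del ^+ 2 / 4 by rewrite divr_gt0// exprn_gt0.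
have [s hs] := prj_quasilocal e0; exists s => A N AN; rewrite leqNgt; apply/negP => NA.
(* The factor [D x] makes the diagonal coefficient [c x x] equal to |eta x|^2. *)
pose D x := cj (crd (u x) (f x)).
have [xi [x1 x1A xi0] xiN] := linear_dependence (fun x y => D x * crd (u x) y) NA.
pose eta x := xi x * D x; pose w := \sum_(x <- A) eta x *: u x.
have nw : l2norm w ^+ 2 = \sum_(x <- A) normc (eta x) ^+ 2 := norm_ortho_sum ortho A eta.
have eta_ge x : del ^+ 2 * normc (xi x) ^+ 2 <= normc (eta x) ^+ 2.
  rewrite /eta normcM exprMn mulrC ler_wpM2l ?sqr_ge0// /D normc_cj.
  by rewrite ler_pXn2r ?nnegrE ?normc_ge0 ?(ltW del0).
pose c x x' := complex.Re (xi x' * cj (eta x) * cj (crd (u x) (f x'))).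
have [t ht] := good_signs c (fset_uniq A).
have cxx x : c x x = normc (eta x) ^+ 2.
  rewrite /c mulrAC -/(D x) -/(eta x) -rc_sqr_normc; exact: erefl.
pose v := \sum_(x <- A) (rc ((-1) ^+ t x) * xi x) *: delta (f x) : ell2 R Y.
have wN y : y \in N -> crd w y = 0.
  move=> yN; rewrite /w crd_sum -[RHS](xiN y yN); apply: eq_bigr => x _.
  by rewrite crdZ /eta mulrA.
have vf y : crd v y != 0 -> exists2 x, x \in A & y = f x.
  move=> vy; apply: contrapT => no; move/eqP: vy; apply;
    rewrite /v crd_sum big1_seq// => x /andP[_ xA].
  rewrite crdZ crd_delta; have [yx|_] := eqVneq y (f x); last by rewrite mulr0.
  by case: no; exists x.
have fv : fsupp v.
  exists (f @` A)%fset => y yA; apply/eqP/negPn/negP => /vf[x xA yx].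
  by move/negP: yA; apply; rewrite yx in_imfset.
have vw : sep s v w.
  move=> y y' /vf[x xA ->] wy; rewrite ltNge; apply/negP => d.
  by move: wy; rewrite wN ?eqxx//; exact: AN d.
pose A0 := [fset x in A | ~~ t x]%fset; pose A1 := [fset x in A | t x]%fset.
have h0 := hs A0 v w fv vw; have h1 := hs A1 v w fv vw.
have key : inner (prj Phi [set` A0] v) w - inner (prj Phi [set` A1] v) w =
   \sum_(x <- A) \sum_(x' <- A) rc ((-1) ^+ t x) * rc ((-1) ^+ t x') * (xi x' * cj (eta x) * cj
     (crd (u x) (f x'))).
  have [_ a0] := prj_projection PhiH [set` A0]; have [_ a1] := prj_projection PhiH [set` A1].
  rewrite a0 a1 -innerBr !prj_ortho_sum -sumrB inner_sumr big_seq [RHS]big_seq.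
  apply: eq_bigr => x xA; rewrite -scalerBl.
  have -> : (if `[< [set` A0] x >] then eta x else 0) - (if `[< [set` A1] x >] then eta x else 0)
    = rc ((-1) ^+ t x) * eta x.
    case: asboolP; case: asboolP; rewrite /= /A0 /A1 !inE xA; case: (t x) => //= _ _.
      by rewrite subr0 expr0 rc1 mul1r.
    by rewrite sub0r expr1 rcN rc1 mulN1r.
  rewrite innerZr inner_suml mulr_sumr; apply: eq_bigr => x' _.
  rewrite innerZl inner_deltal -/(cj _) cjM.
  rewrite cj_rc; ring.
have Resum : complex.Re (\sum_(x <- A) \sum_(x' <- A) rc ((-1) ^+ t x) * rc ((-1) ^+ t x') * (xi
  x' * cj (eta x) * cj (crd (u x) (f x'))))
   = \sum_(x <- A) \sum_(x' <- A) (-1) ^+ t x * (-1) ^+ t x' * c x x'.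
  have ReD (I : Type) (l : seq I) (g : I ->
    R[i]) : complex.Re (\sum_(i <- l) g i) = \sum_(i <- l) complex.Re (g i).
    by elim/big_rec2: _ => // i p q _ <-; case: (g i) => ? ?; case: q.
  rewrite ReD; apply: eq_bigr => x _; rewrite ReD; apply: eq_bigr => x' _.
  rewrite -rcM.
  by rewrite /c; case: (_ * cj (crd _ _)) => p q; rewrite /rc/= mul0r subr0.
have low : l2norm w ^+ 2 <= normc (inner (prj Phi [set` A0] v) w) +
  normc (inner (prj Phi [set` A1] v) w).
  rewrite nw (eq_bigr (fun x => c x x)); last by move=> x _; rewrite cxx.
  apply: (le_trans ht); rewrite -Resum -key.
  apply: (le_trans (Re_le_normc _)); apply: (le_trans (le_normcD _ _)).
  by rewrite normcN.
(* After squaring, one factor del^2 comes from [norm_pushforward] and the other from [eta_ge]. *)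
have vle : del ^+ 2 * l2norm v <= l2norm w.
  rewrite -(@ler_pXn2r _ 2) ?nnegrE ?mulr_ge0 ?l2norm_ge0 ?(ltW del0)//.
  rewrite exprMn nw expr2 -mulrA.
  apply: (@le_trans _ _ (del ^+ 2 * \sum_(x <- A) normc (xi x) ^+ 2)).
    rewrite ler_wpM2l ?sqr_ge0//.
    apply: (le_trans (norm_pushforward A (fun x => rc ((-1) ^+ t x) * xi x))).
    apply: ler_sum => x _; rewrite normcM.
    by rewrite normc_rc normrX normrN1 expr1n mul1r.
  by rewrite mulr_sumr; apply: ler_sum => x _; exact: eta_ge.
have w0 : 0 < l2norm w ^+ 2.
  rewrite nw (big_fsetD1 x1)//=; apply: ltr_wpDr; first by apply: sumr_ge0 => x _; rewrite sqr_ge0.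
  apply: lt_le_trans (eta_ge x1); rewrite mulr_gt0 ?exprn_gt0//.
  by rewrite normc_gt0.
(* Each of the two pairings is thus at most |w|^2 / 4, whereas by [low] their sum is at least
   |w|^2. *)
have : del ^+ 2 / 4 * (l2norm v * l2norm w) <= l2norm w ^+ 2 / 4.
  have := ler_wpM2r (l2norm_ge0 w) vle; rewrite -expr2.
  by rewrite -mulrA; move: (del ^+ 2) (l2norm v) (l2norm w) (l2norm w ^+ 2) => p q r m *; nra.
move: low h0 h1 w0; move: (normc _) (normc _) (_ / 4 * _) (l2norm w ^+ 2) => *; lra.
Qed.

End counting.

(** * The marriage theorem and the conclusion *)

Section hall_condition.
Context {X Y : choiceType}.
Implicit Types (M N : X -> {fset Y}) (A : {fset X}).

Definition nbr M A : {fset Y} := (\bigcup_(x <- A) M x)%fset.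
Definition hall_condition M := forall A, (#|` A| <= #|` nbr M A|)%N.

Lemma in_nbr M A y : reflect (exists2 x, x \in A & y \in M x) (y \in nbr M A).
Proof.
apply: (iffP (bigfcupP _ _ _ _)) => [[x /andP[xA _] yM]|[x xA yM]]; first by exists x.
by exists x => //; rewrite xA.
Qed.

Definition upd M x (S : {fset Y}) := fun z => if z == x then S else M z.

(** Compactness: the sets being finite, some member of the chain is least at each given x, and for a
    finite A a single member attains these minima at all points of A, so it lends its inequality for
    A to the intersection. *)
Lemma hall_chain (C : set (X -> {fset Y})) (M0 : X -> {fset Y}) : C M0 ->
  (forall M, C M -> hall_condition M) ->
  (forall M M', C M -> C M' -> (forall x, M x `<=` M' x)%fset \/ (forall x, M' x `<=` M x)%fset) ->
  exists2 M, hall_condition M & forall M', C M' -> forall x, (M x `<=` M' x)%fset.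
Proof.
move=> CM0 Chall Ctot.
have exm x : exists M, C M /\ forall M', C M' -> (M x `<=` M' x)%fset.
  have [n] := ubnP (#|` M0 x|); elim: n M0 CM0 => // n IH M0 CM0 nM.
  have [h|] := pselect (forall M', C M' -> (M0 x `<=` M' x)%fset); first by exists M0.
  move/existsNP => [M' /not_implyP[CM' nsub]].
  apply: (IH M' CM'); have [/(_ x) s|/(_ x) s] := Ctot _ _ CM0 CM'; first by case: nsub.
  have : (M' x `<` M0 x)%fset by rewrite fproperE s; apply/negP.
  by move=> /fproper_ltn_card h; apply: leq_trans h _; rewrite -ltnS.
have [Mx hMx] := choice exm; exists (fun x => Mx x x); last by move=> M' CM' x; apply: (hMx x).2.
move=> A; have [M CM MA] : exists2 M, C M & forall x, x \in A -> M x = Mx x x.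
  elim/fset1U_rect: A => [|z A zA [M CM MA]]; first by exists M0.
  have [s|s] := Ctot _ _ CM (hMx z).1.
    exists M => // x; rewrite !inE => /orP[/eqP ->|/MA//].
    by apply/eqP; rewrite eqEfsubset s (hMx z).2.
  exists (Mx z) => [|x]; first exact: (hMx z).1.
  rewrite !inE => /orP[/eqP ->//|xA]; apply/eqP; rewrite eqEfsubset -{1}(MA _ xA) s.
  exact: (hMx x).2 _ (hMx z).1.
have -> : nbr (fun x => Mx x x) A = nbr M A.
  by apply: eq_big_seq => x /MA.
exact: Chall.
Qed.

(** A set violating the condition after the removal must contain x; [B] is that set without x. *)
Lemma hall_remove M x y : hall_condition M -> ~ hall_condition (upd M x (M x `\ y)%fset) ->
  exists2 B : {fset X}, x \notin B & (#|` (nbr M B `|` (M x `\ y))%fset| <= #|` B|)%N.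
Proof.
move=> hM /existsNP[A /negP]; rewrite -ltnNge => hA.
have xA : x \in A.
  apply/negPn/negP => xA; move: hA; rewrite ltnNge => /negP; apply.
  rewrite (_ : nbr _ A = nbr M A) ?hM//; apply: eq_big_seq => z zA.
  by rewrite /upd; case: eqP => // zx; move: xA; rewrite -zx zA.
exists (A `\ x)%fset; first by rewrite !inE eqxx.
move: hA; rewrite (cardfsD1 x A) xA add1n ltnS => hA; apply: leq_trans hA.
apply: fsubset_leq_card; apply/fsubsetP => z; rewrite in_fsetU => /orP[/in_nbr[w]|zx].
  rewrite !inE => /andP[wx wA] zw; apply/in_nbr; exists w => //.
  by rewrite /upd (negPf wx).
by apply/in_nbr; exists x => //; rewrite /upd eqxx.
Qed.

(** If two points could each not be removed from [M x], the two tight sets B1, B2 would contradict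
    the inclusion-exclusion count: the union gains the extra element x, while the intersection still
    satisfies Hall's inequality. *)
Lemma hall_minimal M : hall_condition M ->
  (forall M', hall_condition M' -> (forall x, M' x `<=` M x)%fset -> M' = M) ->
  forall x, #|` M x| = 1%N.
Proof.
move=> hM min x; apply/eqP; rewrite eqn_leq; apply/andP; split; last first.
  by have := hM [fset x]%fset; rewrite cardfs1 /nbr big_seq_fset1.
rewrite leqNgt; apply/negP => M2.
have /fset0Pn[y1 y1M] : M x != fset0 by rewrite -cardfs_gt0; exact: leq_trans M2.
have /fset0Pn[y2] : (M x `\ y1)%fset != fset0.
  by rewrite -cardfs_gt0; move: M2; rewrite (cardfsD1 y1) y1M.
rewrite !inE => /andP[y21 y2M].
have rem y : y \in M x -> ~ hall_condition (upd M x (M x `\ y)%fset).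
  move=> yM /min E; have : upd M x (M x `\ y)%fset = M.
    apply: E => z; rewrite /upd; case: eqP => [->|_]; first exact: fsubD1set.
    exact: fsubset_refl.
  move=> /(congr1 (fun m => y \in m x)); rewrite /upd eqxx yM !inE eqxx.
  by [].
have [B1 xB1 h1] := hall_remove hM (rem _ y1M).
have [B2 xB2 h2] := hall_remove hM (rem _ y2M).
set U1 := (nbr M B1 `|` _)%fset in h1; set U2 := (nbr M B2 `|` _)%fset in h2.
(* Since y1 and y2 differ, the two reduced copies of [M x] together cover [M x]. *)
have hU : (#|` (x |` (B1 `|` B2))%fset| <= #|` (U1 `|` U2)%fset|)%N.
  apply: leq_trans (hM _) _; apply: fsubset_leq_card; apply/fsubsetP => y /in_nbr[z].
  rewrite !inE => /or3P[/eqP ->|zB|zB] yz.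
  - by rewrite yz !andbT; have [->|_] := eqVneq y y1; rewrite ?orbT// eq_sym y21 !orbT.
  - by rewrite (_ : y \in nbr M B1)//; apply/in_nbr; exists z.
  - by rewrite (_ : y \in nbr M B2) ?orbT//; apply/in_nbr; exists z.
have hI : (#|` (B1 `&` B2)%fset| <= #|` (U1 `&` U2)%fset|)%N.
  apply: leq_trans (hM _) _; apply: fsubset_leq_card; apply/fsubsetP => y /in_nbr[z].
  rewrite !inE => /andP[z1 z2] yz; apply/andP; split; apply/orP; left.
    by apply/in_nbr; exists z.
  by apply/in_nbr; exists z.
have := leq_add hU hI; rewrite cardfsUI cardfsU1 !inE negb_or xB1 xB2 -addnA cardfsUI.
by move=> h; have := leq_trans h (leq_add h1 h2); rewrite add1n ltnn.
Qed.

(* Rado's proof: by Zorn there is a minimal subsystem satisfying Hall's condition, and minimality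
   forces all its members to be singletons. *)
Theorem hall_marriage N : hall_condition N -> exists2 g : X ->
  Y, injective g & forall x, g x \in N x.
Proof.
move=> hN; pose T := {M : X -> {fset Y} | hall_condition M /\ forall x, (M x `<=` N x)%fset}.
(* The order is reversed inclusion, so a maximal element is a minimal subsystem. *)
pose R (s t : T) := `[< forall x, (sval t x `<=` sval s x)%fset >].
have Nsub x : (N x `<=` N x)%fset by exact: fsubset_refl.
have [t|r s t /asboolP rs /asboolP st|s t /asboolP st /asboolP ts|C Ctot|[M [hM MN]] max] :=
  @Zorn T R.
- by apply/asboolP => x; exact: fsubset_refl.
- by apply/asboolP => x; exact: fsubset_trans (st x) (rs x).
- apply: eq_sig_hprop; first by move=> m p q; exact: Prop_irrelevance.
  by apply/funext => x; apply/eqP; rewrite eqEfsubset st ts.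
- have [[[M0 [hM0 M0N]] CM0]|C0] := pselect (exists t, C t); last first.
    exists (exist _ N (conj hN Nsub)) => s Cs; case: C0; by exists s.
  have [|M [t Ct <-]|M M' [t Ct <-] [t' Ct' <-]|M hM Mmin] := @hall_chain [set sval t | t in C] M0.
  + by exists (exist _ M0 (conj hM0 M0N)).
  + by have [] := svalP t.
  + by have [/asboolP|/asboolP] := Ctot _ _ Ct Ct'; [right|left].
  have MN x : (M x `<=` N x)%fset.
    apply: fsubset_trans (M0N x); apply: Mmin.
    by exists (exist _ M0 (conj hM0 M0N)).
  exists (exist _ M (conj hM MN)) => s Cs; apply/asboolP => x /=.
  by apply: Mmin; exists s.
have M1 x : #|` M x| = 1%N.
  apply: hall_minimal => // M' hM' M'M.
  have M'N z : (M' z `<=` N z)%fset := fsubset_trans (M'M z) (MN z).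
  exact: (congr1 sval (max (exist _ M' (conj hM' M'N)) (asboolT M'M))).
have ex1 x : exists y, M x = [fset y]%fset by apply/cardfs1P; rewrite M1.
have [g hg] := choice ex1; exists g => [x x' E|x]; last first.
  by apply: (fsubsetP (MN x)); rewrite hg inE.
apply/eqP/negPn/negP => xx; have := hM [fset x; x']%fset.
rewrite cardfs2 xx leqNgt => /negP; apply; rewrite ltnS.
have -> : nbr M [fset x; x']%fset = [fset g x]%fset.
  apply/fsetP => y; apply/in_nbr/idP => [[z]|].
    by rewrite !inE => /orP[/eqP ->|/eqP ->]; rewrite hg inE ?E.
  by rewrite inE => /eqP ->; exists x; rewrite ?hg !inE eqxx.
by rewrite cardfs1.
Qed.

End hall_condition.

Lemma coarse_embedding_of_control {R : realType} (X Y : metricType R) (g : X -> Y) :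
  (forall r, exists s, forall x x', mdist x x' <= r -> mdist (g x) (g x') <= s) ->
  (forall r, exists s, forall x x', mdist (g x) (g x') <= r -> mdist x x' <= s) ->
  coarse_embedding g.
Proof.
move=> up lo.
pose P t := [set d : R | d = 0 \/ exists x x', mdist x x' <= t /\ d = mdist (g x) (g x')].
(* The cap q <= t keeps the supremum finite when no two points are at distance at least t; the
   element 0 keeps the set nonempty for negative t. *)
pose L t := [set q : R | q = 0 \/ 0 <= q <= t /\ forall x x', t <= mdist x x' ->
  q <= mdist (g x) (g x')].
have Ps t : has_sup (P t).
  split; first by exists 0; left.
  have [s hs] := up t; exists (Num.max s 0) => d [->|[x [x' [h ->]]]]; rewrite le_max ?lexx ?orbT//.
  by rewrite hs.
have Ls t : has_sup (L t).
  split; first by exists 0; left.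
  exists (Num.max t 0) => q [->|[/andP[_ qt] _]]; rewrite le_max ?lexx ?orbT//.
  by rewrite qt.
exists (fun t => sup (L t)), (fun t => sup (P t)); split.
- split=> s t _ _ st.
    apply: ge_sup; first exact: (Ls s).1.
    move=> q [->|[/andP[q0 qs] h]]; apply: ub_le_sup; try exact: (Ls t).2; first by left.
    right; rewrite q0 (le_trans qs st); split => // x x' tx.
    by apply: h; exact: le_trans st tx.
  apply: ge_sup; first exact: (Ps s).1.
  move=> d [->|[x [x' [h ->]]]]; apply: ub_le_sup; try exact: (Ps t).2; first by left.
  by right; exists x, x'; rewrite (le_trans h st).
- split=> t _; apply: ub_le_sup; try exact: (Ls t).2; try exact: (Ps t).2; by left.
- apply/cvgryPge => K; have [s hs] := lo K.
  exists (Num.max (Num.max K 0) s); split; first exact: num_real.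
  move=> t; rewrite !gt_max => /andP[/andP[Kt t0] st].
  apply: (@le_trans _ _ (Num.max K 0)); first by rewrite le_max lexx.
  apply: ub_le_sup; first exact: (Ls t).2.
  right; rewrite le_max lexx orbT ge_max (ltW Kt) (ltW t0); split => // x x' tx.
  rewrite ge_max mdist_ge0 andbT leNgt; apply/negP => /ltW/hs.
  by move=> xs; have := lt_le_trans st (le_trans tx xs); rewrite ltxx.
- move=> x x'; apply/andP; split.
    apply: ge_sup; first exact: (Ls _).1.
    by move=> q [->|[_ h]]; [exact: mdist_ge0|exact: h].
  apply: ub_le_sup; first exact: (Ps _).2.
  by right; exists x, x'.
Qed.

Theorem corollary1p4 (R : realType) (X Y : metricType R)
    (ulfX : uniformly_locally_finite X) (ulfY : uniformly_locally_finite Y)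
    (Phi : bop R X -> bop R Y)
    (PhiH : star_homomorphism (uniform_roe X) (uniform_roe Y) Phi)
    (Phi_inj : set_inj (uniform_roe X) Phi)
    (Phi_sub : Cstar_subalgebra (uniform_roe Y) (Phi @` uniform_roe X))
    (Phi_her : hereditary (uniform_roe Y) (Phi @` uniform_roe X))
    (ghosts : forall p : bop R Y,
      uniform_roe Y p -> ghost p -> projection p -> compact_op p) :
  exists2 f : X -> Y, injective f & coarse_embedding f.
Proof.
have [u [PhiE ortho]] := frame_exists PhiH Phi_inj Phi_her.
have [del del0 hdel] := rigid PhiH Phi_inj Phi_her PhiE ortho ghosts.
have [f fdel] := choice hdel.
have [s hs] := hall_count ulfX PhiH Phi_inj Phi_her PhiE ortho del0 fdel.
have [B hB] := choice (fun x => ball_fset ulfY (f x) s).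
have [|g ginj gB] := @hall_marriage X Y B.
  move=> A; apply: hs => x y xA xy; apply/in_nbr; exists x => //.
  by rewrite hB.
have gf x : mdist (f x) (g x) <= s by rewrite -hB.
exists g => //; apply: coarse_embedding_of_control => r.
  have [t ht] := upper_control ulfX PhiH Phi_inj Phi_her PhiE ortho r del0.
  (* Passing from [f] to [g] moves each image by at most s, hence changes distances by at most 2 s;
     the same correction occurs in the lower control. *)
  exists (t + 2 * s) => x x' xx; have := ht _ _ _ _ (fdel x) (fdel x') xx.
  have := metric_triangle (g x) (f x) (g x').
  have := metric_triangle (f x) (f x') (g x').
  have := gf x; have := gf x'; rewrite (metric_sym (g x) (f x)); lra.
have [t ht] := lower_control ulfY PhiH Phi_inj Phi_her PhiE ortho (r + 2 * s) del0.
exists t => x x' xx; apply: (ht _ _ _ _ (fdel x) (fdel x')).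
have := metric_triangle (f x) (g x) (f x').
have := metric_triangle (g x) (g x') (f x').
have := gf x; have := gf x'; rewrite (metric_sym (g x') (f x')); lra.
Qed.
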